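(* Let $n \ge 1$ and let $\equiv$ be a simple essential lattice congruence of the weak order on $\mathfrak{S}_n$. Then the Hasse diagram of any $\equiv$-preposet is a Schröder separating tree.
   Context: Notation: $[n]=\{1,\dots,n\}$ and $]i,j[\,=\{i+1,\dots,j-1\}$ for $i<j$. The weak order on the permutations $\mathfrak{S}_n$ of $[n]$ is the lattice defined by $\sigma\le\tau$ iff $\mathrm{inv}(\sigma)\subseteq\mathrm{inv}(\tau)$, where $\mathrm{inv}(\sigma)=\{(\sigma_p,\sigma_q) : p<q,\ \sigma_p>\sigma_q\}$. A lattice congruence is an equivalence relation $\equiv$ on $\mathfrak{S}_n$ compatible with meets and joins; its classes are intervals. Arcs. An arc is a quadruple $(i,j,A,B)$ with $1\le i<j\le n$ and $A\sqcup B={]i,j[}$; $\mathcal{A}_n$ is the set of all arcs. The up arc is $u(i,j)=(i,j,]i,j[,\varnothing)$ and the down arc is $d(i,j)=(i,j,\varnothing,]i,j[)$. The arc $(i,j,A,B)$ is a subarc of $(i',j',A',B')$ if $i'\le i<j\le j'$, $A\subseteq A'$ and $B\subseteq B'$. For an arc $\alpha=(i,j,A,B)$ let $\sigma_\alpha$ be the permutation with a single descent whose one-line notation is $1,\dots,i-1$, then the elements of $A$ in increasing order, then $j$, then $i$, then the elements of $B$ in increasing order, then $j+1,\dots,n$. For a lattice congruence $\equiv$, let $\mathcal{A}_\equiv$ be the set of arcs $\alpha$ such that $\sigma_\alpha$ is the minimum of its $\equiv$-class. (The map $\equiv\ \mapsto\mathcal{A}_\equiv$ is a bijection from the lattice congruences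 of the weak order on $\mathfrak{S}_n$ to the subsets of $\mathcal{A}_n$ closed under taking subarcs.) The congruence $\equiv$ is essential if $\mathcal{A}_\equiv$ contains all arcs $(i,i+1,\varnothing,\varnothing)$, $i\in[n-1]$. It is simple if every arc of $\mathcal{A}_n\setminus\mathcal{A}_\equiv$ having no strict subarc in $\mathcal{A}_n\setminus\mathcal{A}_\equiv$ is an up arc or a down arc. Quotient fan and $\equiv$-preposets. For a permutation $\sigma$, let $C(\sigma)=\{x\in\mathbb{R}^n : x_{\sigma_1}\le\dots\le x_{\sigma_n}\}$. The quotient fan $\mathcal{F}_\equiv$ is the complete fan in $\mathbb{R}^n$ whose maximal cones are the unions $\bigcup_{\sigma\in X}C(\sigma)$ over the $\equiv$-classes $X$ (and whose cones are all the faces of these). A preposet $\preccurlyeq$ on $[n]$ is a reflexive and transitive binary relation; its cone is $C(\preccurlyeq)=\{x\in\mathbb{R}^n : x_i\le x_j\text{ for all } i\preccurlyeq j\}$. Its associated equivalence relation is $i\simeq j$ iff $i\preccurlyeq j$ and $j\preccurlyeq i$, and its Hasse diagram is the directed graph on the $\simeq$-classes with an edge $I\to J$ for each cover relation $I\prec J$ of the quotient poset ${\preccurlyeq}/{\simeq}$. The $\equiv$-preposets are the preposets $\preccurlyeq$ on $[n]$ such that $C(\preccurlyeq)$ is a cone of $\mathcal{F}_\equiv$. Schröder separating trees. In a directed tree $S$ (an orientation of a tree) whose nodes are the parts of a set partition of $[n]$, the parents (resp. children) of a node $J$ are the targets of its outgoing edges (resp. the sources of its incoming edges), and the ancestor (resp.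 descendant) subtrees of $J$ are the connected components of $S\setminus J$ containing its parents (resp. children). A Schröder separating tree is a directed tree on the parts of a set partition of $[n]$ such that any two distinct ancestor (resp. descendant) subtrees of a node $J$ are separated by some integer $j\in J$, meaning that all integers appearing in nodes of one of the two subtrees are smaller than $j$ while all integers appearing in nodes of the other are larger than $j$. *)

(* Defs.v *)
From mathcomp Require Import all_boot all_order all_algebra all_fingroup.
From mathcomp Require Import reals zify.

Set Implicit Arguments.
Unset Strict Implicit.
Unset Printing Implicit Defensive.

Import Order.TTheory GRing.Theory Num.Theory.

(** The set [n] = {1, ..., n} is encoded by ['I_n] = {0, ..., n - 1}: only the
    order of the integers matters, so everything is shifted by one.
    A permutation [s : 'S_n] has one-line notation [s 0, s 1, ..., s (n - 1)],
    i.e. positions are mapped to values. *)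

Section WeakOrder.
Variable n : nat.
Implicit Types (s t m : 'S_n) (e : rel 'S_n).

Definition one_line s : seq 'I_n := [seq s p | p <- enum 'I_n].

(* Inversions are pairs of values, larger value first. *)
Definition inv s : {set 'I_n * 'I_n} :=
  [set (s pq.1, s pq.2) | pq in [set pq : 'I_n * 'I_n | (pq.1 < pq.2)%N
                                                      & (s pq.2 < s pq.1)%N]].

Definition weak_le s t : bool := inv s \subset inv t.

Definition is_meet s t m : Prop :=
  [/\ weak_le m s, weak_le m t &
      forall u : 'S_n, weak_le u s -> weak_le u t -> weak_le u m].

Definition is_join s t m : Prop :=
  [/\ weak_le s m, weak_le t m &
      forall u : 'S_n, weak_le s u -> weak_le t u -> weak_le m u].

(* As the weak order is a lattice, [is_meet s t] and [is_join s t] each hold of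
   exactly one permutation. *)
Definition lattice_congruence e : Prop :=
  [/\ equivalence_rel e,
      forall s s' t t' m m' : 'S_n, e s s' -> e t t' ->
        is_meet s t m -> is_meet s' t' m' -> e m m' &
      forall s s' t t' m m' : 'S_n, e s s' -> e t t' ->
        is_join s t m -> is_join s' t' m' -> e m m'].

Definition class_min e s : bool := [forall t, e s t ==> weak_le s t].

End WeakOrder.

Section Arcs.
Variable n : nat.

Definition oint (i j : 'I_n) : {set 'I_n} := [set k : 'I_n | (i < k < j)%N].

Record quad := Quad {
  qi : 'I_n;
  qj : 'I_n;
  qA : {set 'I_n};
  qB : {set 'I_n}
}.

Implicit Types (a b : quad) (e : rel 'S_n).

Definition is_arc a : bool :=
  [&& (qi a < qj a)%N, qA a :|: qB a == oint (qi a) (qj a)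
    & [disjoint qA a & qB a]].

Definition up_arc (i j : 'I_n) : quad := Quad i j (oint i j) set0.

Definition down_arc (i j : 'I_n) : quad := Quad i j set0 (oint i j).

Definition subarc a b : bool :=
  [&& (qi b <= qi a < qj a)%N, (qj a <= qj b)%N,
      qA a \subset qA b & qB a \subset qB b].

(* [enum] lists a set of ordinals in increasing order. *)
Definition arc_word a : seq 'I_n :=
  enum [set k : 'I_n | (k < qi a)%N] ++ enum (qA a) ++ [:: qj a; qi a]
    ++ enum (qB a) ++ enum [set k : 'I_n | (qj a < k)%N].

(* The permutation whose one-line notation is [arc_word a]; it exists when [a]
   is an arc, see [one_line_arc_perm], and otherwise the value is irrelevant. *)
Definition arc_perm a : 'S_n :=
  odflt (perm_one 'I_n) [pick s : 'S_n | one_line s == arc_word a].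

Lemma arc_word_perm a : is_arc a -> perm_eq (arc_word a) (enum 'I_n).
Proof.
case: a => i j A B; rewrite /is_arc /= => /and3P[ij /eqP AB dAB].
apply/allP => k _ /=; apply/eqP.
have kAB : (k \in A) || (k \in B) = (i < k < j)%N.
  by rewrite -in_setU AB inE.
have kNAB : ~~ ((k \in A) && (k \in B)).
  apply/negP => /andP[kA kB].
  by move/pred0P: dAB => /(_ k) /=; rewrite kA kB.
rewrite /arc_word !count_cat /= !(count_uniq_mem _ (enum_uniq _)).
rewrite !mem_enum !inE -!val_eqE /= !(eq_sym _ (val k)).
by move: kAB kNAB ij; case: (k \in A); case: (k \in B) => //=;
  case: ltngtP => ki; case: ltngtP => kj //=; lia.
Qed.

Lemma one_line_arc_perm a : is_arc a -> one_line (arc_perm a) = arc_word a.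
Proof.
move=> /arc_word_perm aP; rewrite /arc_perm; case: pickP => [s /eqP //|noS].
have sz : size (arc_word a) = n by rewrite (perm_size aP) size_enum_ord.
have un : uniq (arc_word a) by rewrite (perm_uniq aP) enum_uniq.
have inj : injective (fun p : 'I_n => nth p (arc_word a) p).
  move=> p q; rewrite (set_nth_default q) ?sz // => /eqP.
  by rewrite nth_uniq ?sz // => /eqP/val_inj.
have := noS (perm inj); rewrite -[X in _ = X]negbK => /negP[].
apply/eqP; case: (arc_word a) sz inj => [|x w] sz inj.
  by apply: size0nil; rewrite size_map size_enum_ord -sz.
apply: (@eq_from_nth _ x); rewrite size_map size_enum_ord ?sz // => p pn.
rewrite (nth_map (Ordinal pn)) ?size_enum_ord // permE.
have -> : nth (Ordinal pn) (enum 'I_n) p = Ordinal pn.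
  by apply: val_inj; rewrite /= nth_enum_ord.
by apply: set_nth_default; rewrite sz.
Qed.

Definition arcs_of e a : bool := is_arc a && class_min e (arc_perm a).

Definition essential e : Prop :=
  forall i j : 'I_n, j = i.+1 :> nat -> arcs_of e (Quad i j set0 set0).

Definition missing_arc e a : bool := is_arc a && ~~ arcs_of e a.

Definition simple e : Prop :=
  forall a, missing_arc e a ->
    (forall b, missing_arc e b -> subarc b a -> b = a) ->
    (exists i j, a = up_arc i j) \/ (exists i j, a = down_arc i j).

End Arcs.

Section QuotientFan.
Variables (R : realType) (n : nat).
Local Open Scope ring_scope.
Implicit Types (e : rel 'S_n) (r : rel 'I_n) (K F : 'rV[R]_n -> Prop).

Definition perm_cone (s : 'S_n) (x : 'rV[R]_n) : Prop :=
  forall p q : 'I_n, (p <= q)%N -> x 0 (s p) <= x 0 (s q).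

Definition class_cone e (s : 'S_n) (x : 'rV[R]_n) : Prop :=
  exists2 t : 'S_n, e s t & perm_cone t x.

(* [F] is the locus in [K] where a linear form that is nonnegative on [K]
   vanishes; the zero form gives [K] itself. *)
Definition face_of F K : Prop :=
  exists c : 'rV[R]_n,
    (forall x, K x -> 0 <= \sum_i c 0 i * x 0 i) /\
    (forall x, F x <-> K x /\ \sum_i c 0 i * x 0 i = 0).

Definition quotient_fan e F : Prop :=
  exists s : 'S_n, face_of F (class_cone e s).

Definition preposet r : Prop := reflexive r /\ transitive r.

Definition preposet_cone r (x : 'rV[R]_n) : Prop :=
  forall i j : 'I_n, r i j -> x 0 i <= x 0 j.

Definition congruence_preposet e r : Prop :=
  preposet r /\ quotient_fan e (preposet_cone r).

End QuotientFan.

Record digraph (T : finType) := Digraph {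
  nodes : {set T};
  arrow : rel T
}.

Section DirectedTrees.
Variable T : finType.
Implicit Types (D : digraph T) (J : T).

Definition sym_arrow D : rel T := [rel I J | arrow D I J || arrow D J I].

(* The second clause (with [I = J], no loops) says that [D] orients its
   underlying simple graph; the last two say that this graph is a tree. *)
Definition directed_tree D : Prop :=
  [/\ forall I J, arrow D I J -> (I \in nodes D) && (J \in nodes D),
      forall I J, ~~ (arrow D I J && arrow D J I),
      nodes D != set0,
      {in nodes D &, forall I J, connect (sym_arrow D) I J} &
      forall c : seq T, (2 < size c)%N -> ~ ucycle (sym_arrow D) c].

Definition delete_arrow D J : rel T :=
  [rel I K | [&& I != J, K != J & sym_arrow D I K]].

(* The connected component of the node [P] in [D] deprived of [J]. *)
Definition component_without D J (P : T) : {set T} :=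
  [set K in nodes D | connect (delete_arrow D J) P K].

Definition ancestor_subtrees D J : {set {set T}} :=
  [set component_without D J P | P in nodes D & arrow D J P].

Definition descendant_subtrees D J : {set {set T}} :=
  [set component_without D J P | P in nodes D & arrow D P J].

End DirectedTrees.

Section Schroder.
Variable n : nat.
Implicit Types (I J K : {set 'I_n}) (D : digraph {set 'I_n}) (r : rel 'I_n).

Definition all_below (U : {set {set 'I_n}}) (j : 'I_n) : Prop :=
  forall k, k \in cover U -> (k < j)%N.

Definition all_above (U : {set {set 'I_n}}) (j : 'I_n) : Prop :=
  forall k, k \in cover U -> (j < k)%N.

Definition separated_by (j : 'I_n) (U V : {set {set 'I_n}}) : Prop :=
  (all_below U j /\ all_above V j) \/ (all_below V j /\ all_above U j).

Definition pairwise_separated J (F : {set {set {set 'I_n}}}) : Prop :=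
  {in F &, forall U V, U != V -> exists2 j, j \in J & separated_by j U V}.

Definition schroder_separating_tree D : Prop :=
  [/\ partition (nodes D) [set: 'I_n], directed_tree D &
      {in nodes D, forall J, pairwise_separated J (ancestor_subtrees D J) /\
                             pairwise_separated J (descendant_subtrees D J)}].

Definition preposet_equiv r : rel 'I_n := [rel i j | r i j && r j i].

Definition preposet_classes r : {set {set 'I_n}} :=
  equivalence_partition (preposet_equiv r) [set: 'I_n].

Definition class_lt r : rel {set 'I_n} :=
  [rel I J | [&& I \in preposet_classes r, J \in preposet_classes r, I != J
               & [exists i in I, exists j in J, r i j]]].

Definition class_cover r : rel {set 'I_n} :=
  [rel I J | class_lt r I J
             && [forall K, ~~ (class_lt r I K && class_lt r K J)]].

Definition hasse_diagram r : digraph {set 'I_n} :=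
  Digraph (preposet_classes r) (class_cover r).

End Schroder.

(* Main.v *)
Require Import Defs.
From mathcomp Require Import all_boot all_order all_algebra all_fingroup.
From mathcomp Require Import reals.
From mathcomp Require Import zify.

Set Implicit Arguments.
Unset Strict Implicit.
Unset Printing Implicit Defensive.

Import Order.TTheory GRing.Theory Num.Theory.

(** Fix a class of the congruence. It is an interval of the weak order, so it
    consists of all the linear extensions of the intersection [P] of its members
    ([linear_extension]), and its cone is the cone of [P] ([class_coneP]).

    Exchanging two values adjacent in a permutation is a cover of the weak
    order, and whether the congruence contracts it depends only on an arc,
    which records which of the intermediate values come before
    ([arc_contracted]). For a simple congruence, the arc is missing exactly
    when it has a wall as a subarc: a missing up arc all of whose inner values
    come before the exchanged pair, or a missing down arc all of whose inner
    values come after it ([missing_wall], [missing_restr]). Hence incomparable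
    elements of [P] are separated by a wall, and the two ends of a cover
    relation are not. The record [walled] states this for the earliest and the
    latest possible positions of a pair in a linear extension; it is invariant
    under reversal of [P] and under reversal of the values.

    An up wall persists once its inner values have been read: everything above
    an element on one side of it stays on that side ([up_wall_left]). Therefore
    incomparable elements with a common lower bound are separated by an up
    wall, and those with a common upper bound by a down wall. This forces each
    element [j] to have at most one upper cover on each side, and if [j] has
    two, [a < j < b], no cover relation can pass above [j] ([no_edge_above]). A
    lowest vertex of a cycle of the Hasse diagram would have two upper covers
    and a cover relation passing above it, so the Hasse diagram is a forest
    ([hasse_acyclic]); by the same argument the branches of [a] and [b] at [j]
    lie on the two sides of [j] ([branch_separates]). Essential congruences keep
    consecutive values comparable, which makes the forest a tree.

    A preposet [r] whose cone is a face of the cone of [P] is obtained from [P]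
    by reversing some of its cover relations ([face_contraction]): its Hasse
    diagram is the tree of [P] with these edges contracted. A contracted tree
    is a tree, and two ancestor subtrees of a contracted node [J] are attached
    to elements [a] and [b] of [J]; on the path of the tree joining [a] to [b]
    inside [J] some element is left upwards in the directions of both subtrees,
    and it separates them ([valley_separates]). Descendant subtrees are handled
    by reversing [P]. *)

(** * Hasse diagrams and branches of a forest *)

Lemma connect_exit (T : finType) (R : rel T) (a : pred T) x y :
  connect R x y -> a x -> ~~ a y ->
  exists u v, [/\ R u v, a u, ~~ a v, connect R x u & connect R v y].
Proof.
case/connectP=> p; elim: p x => [|z p IHp] x /=.
  by move=> _ -> ax /negP[].
case/andP=> Rxz pz yE ax nay; have [az|naz] := boolP (a z).
  have [u [v [Ruv au nav zu vy]]] := IHp z pz yE az nay.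
  by exists u, v; split=> //; apply: connect_trans zu; apply: connect1.
by exists x, z; split=> //; apply/connectP; exists p.
Qed.

Section Covers.
Variables (T : finType) (Q : rel T).
Hypotheses (Qirr : irreflexive Q) (Qtr : transitive Q).

Definition covers : rel T :=
  [rel x y | Q x y && [forall z, ~~ (Q x z && Q z y)]].

Lemma coversW x y : covers x y -> Q x y.
Proof. by case/andP. Qed.

Lemma covers_between x y z : covers x y -> Q x z -> Q z y -> False.
Proof. by case/andP=> _ /forallP/(_ z) /negP nQ xz zy; apply: nQ; rewrite xz. Qed.

Lemma connect_covers x y : Q x y -> connect covers x y.
Proof.
have [m] := ubnP #|[pred z | Q x z && Q z y]|.
elim: m x y => // m IHm x y ltm Qxy.
case: (boolP [forall z, ~~ (Q x z && Q z y)]) => [nb|].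
  by apply: connect1; apply/andP; split.
case/forallPn=> z; rewrite negbK => /andP[xz zy].
have le_m (A B : pred T) w : w \in B -> w \notin A -> {subset A <= B} ->
    (#|B| < m.+1)%N -> (#|A| < m)%N.
  move=> wB wA AB; rewrite ltnS; apply: leq_trans; apply: proper_card.
  by apply/properP; split; [apply/subsetP | exists w].
apply: (@connect_trans _ _ z).
  apply: IHm => //; apply: (le_m _ _ z) ltm; first by rewrite inE; apply/andP.
    by rewrite inE Qirr andbF.
  by move=> u; rewrite !inE => /andP[-> uz]; apply: Qtr zy.
apply: IHm => //; apply: (le_m _ _ z) ltm; first by rewrite inE; apply/andP.
  by rewrite inE Qirr.
by move=> u; rewrite !inE => /andP[zu ->]; rewrite andbT; apply: Qtr zu.
Qed.

Lemma covers_connect x y : connect covers x y -> x = y \/ Q x y.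
Proof.
case/connectP=> p; elim: p x => [|z p IHp] x /=; first by left.
case/andP=> /coversW xz pz yE; right.
by case: (IHp z pz yE) => [<- //|]; apply: Qtr.
Qed.

Lemma covers_first x y : Q x y -> exists2 z, covers x z & z = y \/ Q z y.
Proof.
move=> xy; case/connectP: (connect_covers xy) => -[|z p] /=.
  by move=> _ yx; rewrite yx Qirr in xy.
case/andP=> xz pz yE; exists z => //.
by apply: covers_connect; apply/connectP; exists p.
Qed.

Definition hasse_adj : rel T := [rel x y | covers x y || covers y x].

Lemma hasse_adjC : symmetric hasse_adj.
Proof. by move=> x y; rewrite /hasse_adj /= orbC. Qed.

Lemma hasse_adj_neq x y : hasse_adj x y -> x != y.
Proof. by case/orP=> /coversW xy; apply: contraTneq xy => ->; rewrite Qirr. Qed.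

End Covers.

Lemma covers_op (T : finType) (Q : rel T) x y :
  covers (fun u v => Q v u) x y = covers Q y x.
Proof. by rewrite /covers /=; congr (_ && _); apply: eq_forallb => z; rewrite andbC. Qed.

Section Graph.
Variables (T : finType) (adj : rel T).
Hypothesis adjC : symmetric adj.

Definition delete (x : T) : rel T := [rel u v | [&& u != x, v != x & adj u v]].

Definition branch (x y : T) : pred T := connect (delete x) y.

(** Forests by deletion of a vertex: distinct neighbours of [x] lie in distinct
    components of the graph deprived of [x]. This local form is the one that
    cuts trees into branches, and it survives contraction more easily than the
    absence of cycles. *)
Definition acyclic := forall x p q, adj x p -> adj x q -> branch x p q -> p = q.

Lemma branch_neq x y z : y != x -> branch x y z -> z != x.
Proof.
move=> yx /connectP[p]; elim: p y yx => [|w p IHp] y yx /=; first by move=> _ ->.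
by case/andP=> /and3P[_ wx _]; apply: IHp.
Qed.

Lemma path_branch x y p : path adj y p -> y != x -> x \notin p ->
  branch x y (last y p).
Proof.
elim: p y => [|z p IHp] y /=; first by rewrite /branch connect0.
case/andP=> yz pz yx; rewrite inE negb_or eq_sym => /andP[zx xp].
apply: connect_trans (IHp z pz zx xp); apply: connect1.
by rewrite /delete /= yx zx.
Qed.

Lemma acyclic_no_ucycle : acyclic ->
  forall c : seq T, (2 < size c)%N -> ~ ucycle adj c.
Proof.
move=> ac [|x [|p c]] //= sz /andP[/= /andP[xp]].
rewrite rcons_path => /andP[pc lx] /and3P[]; rewrite inE negb_or => /andP[nxp xc].
move=> npc uc; have := ac x p (last p c) xp.
rewrite adjC lx => /(_ isT (path_branch pc _ xc)); rewrite eq_sym nxp => /(_ isT) pE.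
by case: c sz pE npc {pc lx xc uc} => //= q c _ pE; rewrite {1}pE mem_last.
Qed.

Lemma no_ucycle_acyclic : irreflexive adj ->
  (forall c : seq T, (2 < size c)%N -> ~ ucycle adj c) -> acyclic.
Proof.
move=> irr nc x p q xp xq /connectP[l0 pl0 qE]; rewrite {}qE in xq *.
case/shortenP: pl0 xq => l pl ul _ xq; apply/eqP/idPn => ne.
have px : p != x by apply: contraTneq xp => ->; rewrite irr.
have xl : x \notin p :: l.
  apply/negP=> xin; suff: all (fun z => z != x) (p :: l).
    by move=> /allP/(_ x xin); rewrite eqxx.
  rewrite /= px /=; elim: l p px pl {ul xq ne xin xp} => //= z l IHl p px.
  by case/andP=> /and3P[_ zx _] /(IHl z zx) ->; rewrite zx.
apply: (nc (x :: p :: l)); first by case: l ne {pl ul xq xl}; rewrite ?eqxx.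
apply/andP; split; last by rewrite /= xl.
rewrite /= xp rcons_path adjC xq andbT.
by apply: sub_path pl => u v /and3P[].
Qed.

(** A path leaving [b] through [q] never comes back to [d], so the branches
    met along a path of a forest are nested. *)
Lemma branch_nest b q d : acyclic -> adj b q -> adj b d -> q != d -> b != d ->
  forall z, branch b q z -> branch d b z.
Proof.
move=> ac bq bd qd bd' z qz.
have/connectP[p pp zE] := qz.
have: branch d q z.
  rewrite zE; apply: path_branch => //; first by apply: sub_path pp => u v /and3P[].
  apply/negP=> /splitPr dp; case: p / dp pp zE => p1 p2; rewrite cat_path.
  case/andP=> pp1 /=/andP[p1d _] _; move/eqP: qd; apply; apply: ac bq bd _.
  by apply/connectP; exists (rcons p1 d); rewrite ?last_rcons // rcons_path pp1.
by apply: connect_trans; apply: connect1; rewrite /delete /= bd' qd.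
Qed.

End Graph.

(** * Posets cut by walls *)

Section Walled.
Variable T : finType.

Definition between (h : T -> nat) (a z b : T) : bool := (h a < h z < h b)%N.

(** The pair [i], [k] in increasing order lies between [x] and [y], ends
    included, whichever of [x] and [y] is the larger. *)
Definition hull (h : T -> nat) (x y i k : T) : bool :=
  [&& (minn (h x) (h y) <= h i)%N, (h i < h k)%N & (h k <= maxn (h x) (h y))%N].

Lemma hull_le h x y i k : (h x <= h i)%N -> (h i < h k)%N -> (h k <= h y)%N ->
  hull h x y i k.
Proof. by rewrite /hull; lia. Qed.

Lemma hullC h x y i k : hull h x y i k = hull h y x i k.
Proof. by rewrite /hull minnC maxnC. Qed.

Lemma hull_lt h x y i k : (h x < h y)%N -> hull h x y i k ->
  [/\ h x <= h i, h i < h k & h k <= h y]%N.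
Proof. by rewrite /hull => xy H; split; lia. Qed.

(** [h] gives the values of the elements. [up i k] is a wall wherever all the
    elements strictly between [i] and [k] have been read, and [down i k]
    wherever none of them has. When [x] and [y] are consecutive in a linear
    extension, the set of elements read before them can be as small as the
    elements below one of them, or as large as the elements above none of them.
    A cover relation has no wall between its ends: it is enough to exclude up
    walls for the largest set and down walls for the smallest one. Incomparable
    elements have a wall between them in both cases. *)
Record walled (P : rel T) (h : T -> nat) (up down : rel T) : Prop := Walled {
  walled_irr : irreflexive P;
  walled_trans : transitive P;
  walled_inj : injective h;
  cover_no_up : forall x y i k, covers P x y -> hull h x y i k -> up i k ->
    exists2 z, between h i z k & P x z;
  cover_no_down : forall x y i k, covers P x y -> hull h x y i k -> down i k ->
    exists2 z, between h i z k & P z y;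
  incomparable_low : forall x y, x != y -> ~~ P x y -> ~~ P y x ->
    exists i k, hull h x y i k /\
      ((up i k /\ forall z, between h i z k -> P z x || P z y) \/
       (down i k /\ forall z, between h i z k -> ~~ P z x && ~~ P z y));
  incomparable_high : forall x y, x != y -> ~~ P x y -> ~~ P y x ->
    exists i k, hull h x y i k /\
      ((down i k /\ forall z, between h i z k -> P x z || P y z) \/
       (up i k /\ forall z, between h i z k -> ~~ P x z && ~~ P y z))
}.

(** Reading linear extensions backwards exchanges up and down walls. *)
Lemma walled_op P h up down :
  walled P h up down -> walled (fun x y => P y x) h down up.
Proof.
case=> irr tr inj eu ed wmin wmax; split => //.
- by move=> y x z xy yz; apply: tr yz xy.
- move=> x y i k; rewrite covers_op => c hl d; apply: ed c _ d.
  by rewrite hullC.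
- move=> x y i k; rewrite covers_op => c hl d; apply: eu c _ d.
  by rewrite hullC.
- by move=> x y xy nx ny; apply: wmax.
- by move=> x y xy nx ny; apply: wmin.
Qed.

Definition mirror (h : T -> nat) (x : T) : nat := (\max_y h y - h x)%N.

Lemma mirror_le h x y : (mirror h x <= mirror h y)%N = (h y <= h x)%N.
Proof.
have hM z : (h z <= \max_y h y)%N by apply: leq_bigmax.
by rewrite /mirror; move: (hM x) (hM y); lia.
Qed.

Lemma mirror_lt h x y : (mirror h x < mirror h y)%N = (h y < h x)%N.
Proof. by rewrite !ltnNge mirror_le. Qed.

Lemma mirror_hull h x y i k : hull (mirror h) x y i k = hull h x y k i.
Proof.
move: (mirror_le h x i) (mirror_le h y i) (mirror_lt h i k).
move: (mirror_le h k x) (mirror_le h k y).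
by rewrite /hull; lia.
Qed.

Lemma mirror_between h i z k : between (mirror h) i z k = between h k z i.
Proof. by rewrite /between !mirror_lt andbC. Qed.

Lemma walled_mirror P h up down : walled P h up down ->
  walled P (mirror h) (fun i k => up k i) (fun i k => down k i).
Proof.
case=> irr tr inj eu ed wmin wmax; split => //.
- move=> x y e; apply: inj; apply/eqP.
  by rewrite eqn_leq -!(mirror_le h) e leqnn.
- move=> x y i k c; rewrite mirror_hull => H u.
  by have [z bz xz] := eu _ _ _ _ c H u; exists z; rewrite ?mirror_between.
- move=> x y i k c; rewrite mirror_hull => H u.
  by have [z bz xz] := ed _ _ _ _ c H u; exists z; rewrite ?mirror_between.
- move=> x y xy nx ny; have [i [k [H D]]] := wmin x y xy nx ny.
  exists k, i; rewrite mirror_hull; split=> //.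
  by case: D => -[u D]; [left|right]; split=> // z; rewrite mirror_between; apply: D.
- move=> x y xy nx ny; have [i [k [H D]]] := wmax x y xy nx ny.
  exists k, i; rewrite mirror_hull; split=> //.
  by case: D => -[u D]; [left|right]; split=> // z; rewrite mirror_between; apply: D.
Qed.

Section Left.
Variables (P : rel T) (h : T -> nat) (up down : rel T).
Hypothesis w : walled P h up down.
Let irr := walled_irr w.
Let tr := walled_trans w.

Lemma walled_asym x y : P x y -> P y x -> False.
Proof. by move=> xy yx; have := tr xy yx; rewrite irr. Qed.

(** A chain going up from [x] cannot stop inside the wall, whose elements are
    not above [x]; and a cover relation passing over the wall would need one of
    these elements above its lower end, hence above [x]. *)
Lemma up_wall_left x i k u : up i k -> (h x <= h i < h k)%N ->
  (forall z, between h i z k -> ~~ P x z) -> P x u -> (h u <= h i)%N.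
Proof.
move=> uik /andP[xi ik] nP /(connect_covers irr tr) xu; rewrite leqNgt; apply/negP=> iu.
have nu : ~~ (h u <= h i)%N by rewrite -ltnNge.
have [c [c' [cc' ci]]] := @connect_exit _ _ (fun z => h z <= h i)%N _ _ xu xi nu.
rewrite -ltnNge => ic' xc _.
have xcP : x = c \/ P x c by apply: covers_connect xc.
have xc'P : P x c' by case: xcP => [->|xc']; [apply: coversW|apply: tr xc' (coversW cc')].
have [kc'|c'k] := leqP (h k) (h c').
  have [||z bz cz] := cover_no_up w cc' (i := i) (k := k) => //.
    exact: hull_le.
  have /negP := nP z bz; apply; case: xcP => [->//|xc']; exact: tr cz.
have bc' : between h i c' k by rewrite /between; lia.
by have := nP c' bc'; rewrite xc'P.
Qed.

End Left.

Section Up.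
Variables (P : rel T) (h : T -> nat) (up down : rel T).
Hypothesis w : walled P h up down.
Let inj := walled_inj w.

Lemma up_wall_right y i k u : up i k -> (h i < h k <= h y)%N ->
  (forall z, between h i z k -> ~~ P y z) -> P y u -> (h k <= h u)%N.
Proof.
move=> uik /andP[ik ky] nP yu; rewrite -(mirror_le h).
apply: (@up_wall_left _ _ _ _ (walled_mirror w) y k i u uik _ _ yu).
  by rewrite mirror_le mirror_lt ky.
by move=> z; rewrite mirror_between; apply: nP.
Qed.

Lemma up_wall_sides x y i k : up i k -> (h x < h y)%N -> hull h x y i k ->
  (forall z, between h i z k -> ~~ P x z && ~~ P y z) ->
  (forall u, P x u -> h u <= h i)%N /\ (forall u, P y u -> h k <= h u)%N.
Proof.
move=> uik xy hl nP; split=> u; [apply: (up_wall_left w uik)|apply: (up_wall_right uik)];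
    by [case: (hull_lt xy hl) => *; apply/andP | move=> z /nP/andP[]].
Qed.

Lemma no_up_wall x y i k u : up i k -> x != y -> hull h x y i k ->
  (forall z, between h i z k -> ~~ P x z && ~~ P y z) -> P x u -> P y u -> False.
Proof.
move=> uik; wlog xy : x y / (h x < h y)%N.
  move=> H; case: (ltngtP (h x) (h y)) => [/H//|yx|/inj->]; last by rewrite eqxx.
  rewrite eq_sym => ne hl nP xu yu.
  apply: (H y x yx) => //; first by rewrite hullC.
  by move=> z /nP; rewrite andbC.
move=> _ hl nP xu yu.
have [/(_ u xu) ui /(_ u yu) ku] := up_wall_sides uik xy hl nP.
have [_ ik _] := hull_lt xy hl.
by have := leq_trans ik (leq_trans ku ui); rewrite ltnn.
Qed.
End Up.

Section Split.
Variables (P : rel T) (h : T -> nat) (up down : rel T).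
Hypothesis w : walled P h up down.
Let tr := walled_trans w.
Let inj := walled_inj w.
Let w' := walled_op w.

(** A down wall would confine the elements below [x] and [y] to its two sides,
    which excludes a common lower bound: the wall has to be an up wall, and it
    then confines the elements above. *)
Lemma split_up d x y : P d x -> P d y -> (h x < h y)%N -> ~~ P x y -> ~~ P y x ->
  exists i k, [/\ up i k, [/\ h x <= h i, h i < h k & h k <= h y]%N,
    forall z, between h i z k -> P z x || P z y,
    forall u, P x u -> (h u <= h i)%N & forall u, P y u -> (h k <= h u)%N].
Proof.
move=> dx dy xy nxy nyx; have ne : x != y by apply: contraTneq xy => ->; rewrite ltnn.
have [i [k [hl [[uik bP]|[dik bP]]]]] := incomparable_low w ne nxy nyx; last first.
  by case: (no_up_wall w' dik ne hl bP dx dy).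
have [|xl yr] := up_wall_sides w uik xy hl.
  move=> z /bP zP; apply/andP; split; apply/negP => Pz; case/orP: zP => zP.
  - exact (walled_asym w Pz zP).
  - by rewrite (tr Pz zP) in nxy.
  - by rewrite (tr Pz zP) in nyx.
  - exact (walled_asym w Pz zP).
by exists i, k; split=> //; apply: hull_lt.
Qed.

(** Two covers of [j] are incomparable and have the common lower bound [j], so
    an up wall separates them; when they are on the same side of [j] this wall
    lies between the ends of one of the two cover relations. *)
Lemma cover_unique_left j a b : covers P j a -> covers P j b ->
  (h a < h j)%N -> (h b < h j)%N -> a = b.
Proof.
wlog ab : a b / (h a < h b)%N.
  by move=> H; case: (ltngtP (h a) (h b)) => [/H//|ba ja jb aj bj|/inj//]; rewrite (H b a).
move=> ja jb aj bj.
have nab : ~~ P a b.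
  by apply/negP=> pab; apply: covers_between jb (coversW ja) pab.
have nba : ~~ P b a.
  by apply/negP=> pba; apply: covers_between ja (coversW jb) pba.
have [i [k [uik [ai ik kb] bP _ _]]] := split_up (coversW ja) (coversW jb) ab nab nba.
have [|z bz jz] := cover_no_up w ja (i := i) (k := k) _ uik.
  by rewrite hullC; apply: hull_le => //; apply: leq_trans kb (ltnW bj).
by case/orP: (bP z bz) => zP; [case: (covers_between ja jz zP)|case: (covers_between jb jz zP)].
Qed.

(** If [z] were neither above [x] nor below [y], it would be incomparable to
    [x], and a wall between [x] and [z] would contradict the cover relation. *)
Lemma cover_comparable_right x y z : covers P x y -> (h x < h z < h y)%N ->
  P x z || P z y.
Proof.
move=> xy /andP[xz zy].
have ne : x != z by apply: contraTneq xz => ->; rewrite ltnn.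
apply/norP=> -[nxz nzy]; have [zx|nzx] := boolP (P z x).
  by rewrite (tr zx (coversW xy)) in nzy.
have [i [k [hl D]]] := incomparable_high w ne nxz nzx.
have [xi ik kz] := hull_lt xz hl.
have {}hl : hull h x y i k by apply: hull_le => //; apply: leq_trans kz (ltnW zy).
case: D => [[dik bP]|[uik bP]].
  have [t bt ty] := cover_no_down w xy hl dik.
  case/orP: (bP t bt) => Pt; first by case: (covers_between xy Pt ty).
  by rewrite (tr Pt ty) in nzy.
have [t bt xt] := cover_no_up w xy hl uik.
by have := bP t bt; rewrite xt.
Qed.

End Split.

Section Unique.
Variables (P : rel T) (h : T -> nat) (up down : rel T).
Hypothesis w : walled P h up down.
Let wop := walled_op w.
Let wmir := walled_mirror w.

Lemma cover_unique_right j a b : covers P j a -> covers P j b ->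
  (h j < h a)%N -> (h j < h b)%N -> a = b.
Proof.
by move=> ja jb; rewrite -!(mirror_lt h); apply: (cover_unique_left wmir) ja jb.
Qed.

Lemma cocover_unique_left j a b : covers P a j -> covers P b j ->
  (h a < h j)%N -> (h b < h j)%N -> a = b.
Proof. by rewrite -!(covers_op P); apply: (cover_unique_left wop). Qed.

Lemma cover_comparable x y z : covers P x y ->
  between h x z y || between h y z x -> P x z || P z y.
Proof.
move=> xy /orP[|]; first exact: (cover_comparable_right w xy).
by rewrite -mirror_between; apply: (cover_comparable_right wmir xy).
Qed.

Lemma split_down d x y : P x d -> P y d -> (h x < h y)%N -> ~~ P x y -> ~~ P y x ->
  exists i k, [/\ down i k, [/\ h x <= h i, h i < h k & h k <= h y]%N,
    forall z, between h i z k -> P x z || P y z,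
    forall u, P u x -> (h u <= h i)%N & forall u, P u y -> (h k <= h u)%N].
Proof. by move=> xd yd xy nxy nyx; apply: (split_up wop xd yd). Qed.

(** The up wall separating [a] and [b] passes over [j], the element [y] is to
    the right of this wall, and [x] is to the left of [j]. If [y] is [b], the
    elements [x] and [j] are two lower covers of [y] on the same side.
    Otherwise [x] and [b] are incomparable elements below [y], so a down wall
    separates them; it is to the left of [j], since [j] is below [b], and thus
    between the ends of the cover relation from [x] to [y]. Its inner elements
    are above [x], because those above [b] are beyond the up wall; this is what
    a cover relation excludes. *)
Lemma no_edge_above_right j a b x y : covers P j a -> covers P j b ->
  (h a < h j < h b)%N -> covers P x y -> between h x j y || between h y j x ->
  y = b \/ P b y -> False.
Proof.
move=> ja jb /andP[aj jb'] xy bt yb.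
have ab := ltn_trans aj jb'.
have nab : ~~ P a b.
  by apply/negP=> pab; apply: covers_between jb (coversW ja) pab.
have nba : ~~ P b a.
  by apply/negP=> pba; apply: covers_between ja (coversW jb) pba.
have [i [k [uik [ai ik kb] bP _ ub]]] := split_up w (coversW ja) (coversW jb) ab nab nba.
have noj : ~ exists2 z, between h i z k & P j z.
  case=> z bz jz; case/orP: (bP z bz) => zP;
  by [case: (covers_between ja jz zP)|case: (covers_between jb jz zP)].
have ij : (h i < h j)%N.
  rewrite ltnNge; apply/negP=> ji; apply: noj; apply: (cover_no_up w jb _ uik).
  exact: hull_le.
have jk : (h j < h k)%N.
  rewrite ltnNge; apply/negP=> kj; apply: noj; apply: (cover_no_up w ja _ uik).
  by rewrite hullC; apply: hull_le.
have ky : (h k <= h y)%N by case: yb => [->//|/ub].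
have /andP[xj jy] : between h x j y.
  case/orP: bt => // /andP[yj _]; have := leq_trans jk ky.
  by rewrite ltnNge (ltnW yj).
have nbx : ~~ P b x.
  by apply/negP=> /ub kx; have := leq_trans (ltn_trans xj jk) kx; rewrite ltnn.
case: yb => [yb|by'].
  rewrite yb in xy; have xeq := cocover_unique_left xy jb (ltn_trans xj jb') jb'.
  by rewrite xeq ltnn in xj.
have nxb : ~~ P x b by apply/negP=> xb; apply: covers_between xy xb by'.
have xb := ltn_trans xj jb'.
have [i' [k' [dik [xi ik' kb'] bP' _ lb]]] := split_down (coversW xy) by' xb nxb nbx.
have k'j := lb j (coversW jb).
have [|z bz zy] := cover_no_down w xy (i := i') (k := k') _ dik.
  by apply: hull_le => //; apply: leq_trans k'j (ltnW jy).
case/orP: (bP' z bz) => Pz; first exact: (covers_between xy Pz zy).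
have /andP[_ zk'] := bz; have := leq_trans (leq_trans zk' k'j) (ltnW jk).
by rewrite ltnNge (ub z Pz).
Qed.

End Unique.

Section Forest.
Variables (P : rel T) (h : T -> nat) (up down : rel T).
Hypothesis w : walled P h up down.
Let irr := walled_irr w.
Let tr := walled_trans w.
Let inj := walled_inj w.
Let wop := walled_op w.
Let wmir := walled_mirror w.

Lemma cover_sides j a b : covers P j a -> covers P j b -> a != b ->
  (h a < h j < h b)%N || (h b < h j < h a)%N.
Proof.
move=> ja jb ne.
have hne c : covers P j c -> h j != h c.
  move=> jc; apply/eqP=> /inj jE; have := coversW jc; by rewrite jE irr.
have := hne a ja; have := hne b jb.
case: (ltngtP (h a) (h j)) => // aj; case: (ltngtP (h b) (h j)) => // bj _ _.
  by rewrite (cover_unique_left w ja jb aj bj) eqxx in ne.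
by rewrite (cover_unique_right w ja jb aj bj) eqxx in ne.
Qed.

(** An element above [j] is above one of its two upper covers, as there is no
    third one. *)
Lemma no_edge_above j a b x y : covers P j a -> covers P j b -> a != b ->
  covers P x y -> between h x j y || between h y j x -> P j y -> False.
Proof.
move=> ja jb ne; wlog /andP[aj bj] : a b ja jb ne / (h a < h j < h b)%N.
  move=> H; case/orP: (cover_sides ja jb ne) => ab; first exact: H ab.
  by apply: H ab; rewrite // eq_sym.
move=> xy bt jy; have [c jc cy] := covers_first irr tr jy.
have yc : y = c \/ P c y by case: cy; [left|right].
have [ca|nca] := eqVneq c a.
  rewrite ca in yc; apply: (no_edge_above_right wmir jb ja _ xy _ yc).
    by rewrite !mirror_lt aj bj.
  by rewrite !mirror_between orbC.
have [cb|ncb] := eqVneq c b.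
  by rewrite cb in yc; apply: (no_edge_above_right w ja jb _ xy bt yc); rewrite aj bj.
have := cover_sides jc jb ncb; have := cover_sides jc ja nca.
by clear -aj bj; lia.
Qed.

(** A Hasse edge passing over or under [j] comes with its orientation and with
    the side on which it passes. *)
Lemma crossing_edge x y j : hasse_adj P x y -> (h x < h j < h y)%N ->
  exists u v, [/\ covers P u v, between h u j v || between h v j u,
    (u = x /\ v = y) \/ (u = y /\ v = x) & P u j || P j v].
Proof.
case/orP=> c bt; [exists x, y|exists y, x]; split; rewrite /between ?bt ?orbT //.
- by left.
- by apply: (cover_comparable w c); rewrite /between bt.
- by right.
- by apply: (cover_comparable w c); rewrite /between bt orbT.
Qed.

Lemma exists_minimal (c : seq T) x : x \in c ->
  exists2 j, j \in c & forall z, z \in c -> ~~ P z j.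
Proof.
move=> xc; case: (arg_minnP (fun j => #|[pred z | P z j]|) xc) => j jc jmin.
exists j => // z zc; apply/negP=> zj; have := jmin z zc; rewrite leqNgt => /negP; apply.
apply: proper_card; apply/properP; split.
  by apply/subsetP => u; rewrite !inE => uz; apply: tr uz zj.
by exists z; rewrite !inE ?irr.
Qed.

(** A minimal element [j] of a cycle has both its neighbours above it, on
    different sides. The rest of the cycle joins them, so one of its edges
    passes over or under [j]: over is excluded by [no_edge_above], under by the
    minimality of [j]. *)
Lemma hasse_no_ucycle (c : seq T) : (2 < size c)%N -> ~ ucycle (hasse_adj P) c.
Proof.
move=> sz uc; have [x xc] : exists x, x \in c.
  by case: c sz {uc} => // x c _; exists x; rewrite mem_head.
have [j jc jmin] := exists_minimal xc.
have [i c' rc] := rot_to jc.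
have jmin' z : z \in j :: c' -> ~~ P z j by rewrite -rc mem_rot; apply: jmin.
have {uc} : ucycle (hasse_adj P) (j :: c').
  by case/andP: uc => cc ucc; rewrite -rc /ucycle rot_cycle cc rot_uniq.
have {sz} : (2 < size (j :: c'))%N by rewrite -rc size_rot.
case: c' {rc} jmin' => [|a [|b' c']] //= jmin' _.
set l := b' :: c'; set b := last b' c'.
rewrite /ucycle /= rcons_path -/b => /andP[/and3P[ja ab' /andP[pc bj]] /and3P[jl al _]].
have up_j z : z \in j :: a :: l -> hasse_adj P j z -> covers P j z.
  by move=> zin /orP[//|/coversW zj]; have := jmin' z zin; rewrite zj.
have bl : b \in l by apply: mem_last.
have {}ja : covers P j a by apply: up_j => //; rewrite !inE eqxx orbT.
have jb : covers P j b by apply: up_j; rewrite ?(hasse_adjC _ j) // !in_cons -in_cons bl !orbT.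
have ab : a != b by apply: contraNneq al => ->.
pose R := [rel u v | [&& u \in a :: l, v \in a :: l & hasse_adj P u v]].
have Rab : connect R a b.
  apply/connectP; exists l => //; apply: (@sub_in_path _ (mem (a :: l)) (hasse_adj P)).
  - by move=> u v ul vl uv; apply/and3P.
  - exact/allP.
  - by rewrite /= ab'.
have Rj u v : R u v -> [/\ u != j, v != j, ~~ P u j, ~~ P v j & hasse_adj P u v].
  case/and3P=> ul vl uv.
  have nj z : z \in a :: l -> z != j by apply: contraTneq => ->.
  by split; rewrite // ?nj //; apply: jmin'; rewrite in_cons ?ul ?vl orbT.
have cross u v : R u v -> (h u < h j < h v)%N || (h v < h j < h u)%N -> False.
  move=> /Rj[_ _ nuj nvj uv] bt.
  have [x1 [y1 [xy1 bt1 xyE]]] : exists x1 y1, [/\ covers P x1 y1,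
      between h x1 j y1 || between h y1 j x1,
      (x1 = u /\ y1 = v) \/ (x1 = v /\ y1 = u) & P x1 j || P j y1].
    case/orP: bt => bt; first exact: crossing_edge.
    have [|x1 [y1 [? ? ? ?]]] := @crossing_edge v u j _ bt; first by rewrite hasse_adjC.
    by exists x1, y1; split=> //; tauto.
  case/orP=> Pj; last exact: (no_edge_above ja jb ab xy1 bt1 Pj).
  by case: xyE Pj => -[-> _]; apply/negP.
have hne u : u != j -> h u != h j by apply: contra => /eqP/inj->.
case/orP: (cover_sides ja jb ab) => /andP[h1 h2].
  have nb : ~~ (h b < h j)%N by rewrite -leqNgt ltnW.
  have [u [v [uv uj vj _ _]]] := @connect_exit _ _ (fun z => h z < h j)%N _ _ Rab h1 nb.
  have [_ vnj _ _ _] := Rj _ _ uv; apply: (cross u v uv).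
  by rewrite uj ltn_neqAle [h j == _]eq_sym hne //= leqNgt vj.
have nb : ~~ (h j < h b)%N by rewrite -leqNgt ltnW.
have [u [v [uv uj vj _ _]]] := @connect_exit _ _ (fun z => h j < h z)%N _ _ Rab h2 nb.
have [_ vnj _ _ _] := Rj _ _ uv; apply: (cross u v uv).
by apply/orP; right; rewrite uj andbT ltn_neqAle hne //= leqNgt vj.
Qed.

Lemma hasse_acyclic : acyclic (hasse_adj P).
Proof.
apply: no_ucycle_acyclic; [exact: hasse_adjC| |exact: hasse_no_ucycle].
by move=> x; apply/negP=> /(hasse_adj_neq irr); rewrite eqxx.
Qed.

Lemma below_branch j c x : x = c \/ P x c -> P c j -> branch (hasse_adj P) j x c.
Proof.
move=> xc cj; have {xc} : connect (covers P) x c.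
  by case: xc => [->|/(connect_covers irr tr)//]; exact: connect0.
case/connectP=> p pp cE.
have jp : j \notin x :: p.
  apply/negP=> jin; have : connect (covers P) j c.
    case/splitPl: jin pp cE => p1 p2 lp1; rewrite cat_path last_cat lp1.
    by case/andP=> _ pp2 ->; apply/connectP; exists p2.
  case/(covers_connect tr) => [jc|jc]; last exact: (walled_asym w jc cj).
  by rewrite jc irr in cj.
move: jp; rewrite inE negb_or eq_sym => /andP[xj jp].
rewrite cE; apply: path_branch => //.
by apply: sub_path pp => u v uv; apply/orP; left.
Qed.

(** A path in the branch that reaches the right of [j] has an edge passing
    under [j], as none passes over it, hence a vertex below [j]. From this
    vertex a chain reaches [j] through one of its lower covers, which is then a
    second neighbour of [j] in the branch of [a]. *)
Lemma branch_left j a b z : covers P j a -> covers P j b -> (h a < h j < h b)%N ->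
  branch (hasse_adj P) j a z -> (h z < h j)%N.
Proof.
move=> ja jb /andP[aj jb'] az; rewrite ltnNge; apply/negP=> jz.
have ab : a != b by apply: contraTneq aj => ->; rewrite -leqNgt ltnW.
have nz : ~~ (h z < h j)%N by rewrite -leqNgt.
have [u [v [uv uj vj au vz]]] := @connect_exit _ _ (fun z => h z < h j)%N _ _ az aj nz.
have [_ vnj adjuv] := and3P uv.
have jv : (h j < h v)%N by rewrite ltn_neqAle leqNgt vj andbT; apply: contraNneq vnj => /inj->.
have av : branch (hasse_adj P) j a v by apply: connect_trans au (connect1 uv).
have bt : (h u < h j < h v)%N by rewrite uj.
have [x [y [xy bt' xyE /orP[xj|jy]]]] := crossing_edge adjuv bt; last first.
  exact: (no_edge_above ja jb ab xy bt' jy).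
have [c] := covers_first (walled_irr wop) (walled_trans wop) xj.
rewrite covers_op => cj xc.
have ac : branch (hasse_adj P) j a c.
  have ax : branch (hasse_adj P) j a x by case: xyE => -[-> _].
  apply: connect_trans ax (below_branch _ (coversW cj)).
  by case: xc => [->|?]; [left|right].
have adja : hasse_adj P j a by apply/orP; left.
have adjc : hasse_adj P j c by apply/orP; right.
have ace := hasse_acyclic adja adjc ac; rewrite -ace in cj.
exact: (walled_asym w (coversW cj) (coversW ja)).
Qed.

End Forest.

Section Separation.
Variables (P : rel T) (h : T -> nat) (up down : rel T).
Hypothesis w : walled P h up down.

Definition split_at (j : T) (A B : pred T) : Prop :=
  (forall z, A z -> h z < h j)%N /\ (forall z, B z -> h j < h z)%N.

Definition separates (j : T) (A B : pred T) : Prop :=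
  split_at j A B \/ split_at j B A.

Lemma branch_separates j a b : covers P j a -> covers P j b -> a != b ->
  separates j (branch (hasse_adj P) j a) (branch (hasse_adj P) j b).
Proof.
wlog ab : a b / (h a < h j < h b)%N.
  move=> H ja jb ne; case/orP: (cover_sides w ja jb ne) => ab; first exact: H.
  by case: (H b a ab jb ja _); rewrite 1?eq_sym //; [right|left].
move=> ja jb _; left; split=> z; first exact: (branch_left w ja jb ab).
rewrite -(mirror_lt h); apply: (branch_left (walled_mirror w) jb ja).
by rewrite !mirror_lt andbC.
Qed.

End Separation.
End Walled.

(** * The weak order as a lattice *)

Notation inversions := Defs.inv.

Section Permutations.
Variable n : nat.
Implicit Types (s t u m : 'S_n) (x y a b c : 'I_n).

Definition precedes s : rel 'I_n := [rel x y | ((s^-1)%g x < (s^-1)%g y)%N].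

Lemma precedes_irr s : irreflexive (precedes s).
Proof. by move=> x; rewrite /precedes /= ltnn. Qed.

Lemma precedes_trans s : transitive (precedes s).
Proof. by move=> y x z; apply: ltn_trans. Qed.

Lemma precedesN s x y : x != y -> ~~ precedes s x y = precedes s y x.
Proof.
move=> ne; rewrite /precedes /= -leqNgt leq_eqVlt; case: eqP => //= /val_inj/perm_inj e.
by rewrite e eqxx in ne.
Qed.

Lemma precedes_asym s x y : precedes s x y -> ~~ precedes s y x.
Proof. by rewrite /precedes /= -leqNgt; apply: ltnW. Qed.

Lemma mem_inv s c a : ((c, a) \in inversions s) = (a < c)%N && precedes s c a.
Proof.
apply/imsetP/andP => [[[p q]]|[ac ca]].
  by rewrite inE /= => /andP[pq qp] [-> ->]; rewrite /precedes /= !permK.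
by exists ((s^-1)%g c, (s^-1)%g a); rewrite ?inE /= ?permKV //; apply/andP.
Qed.

Lemma weak_leP s t :
  reflect (forall c a, (c, a) \in inversions s -> (c, a) \in inversions t) (weak_le s t).
Proof.
by apply: (iffP subsetP) => H; [move=> c a; apply: H|case=> c a; apply: H].
Qed.

Lemma weak_le_refl s : weak_le s s.
Proof. exact: subxx. Qed.

Lemma inv_trans s a b c :
  (c, b) \in inversions s -> (b, a) \in inversions s -> (c, a) \in inversions s.
Proof.
rewrite !mem_inv => /andP[bc cb] /andP[ab ba].
by rewrite (ltn_trans ab bc) (precedes_trans cb ba).
Qed.

(** Together with [inv_trans], this characterizes the inversion sets. *)
Lemma inv_cotrans s a b c : (a < b)%N -> (b < c)%N -> (c, a) \in inversions s ->
  (c, b) \in inversions s \/ (b, a) \in inversions s.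
Proof.
move=> ab bc; rewrite !mem_inv ab bc /= => /andP[_ ca].
have [cb|] := boolP (precedes s c b); first by left.
rewrite precedesN => [bc'|]; last by apply: contraTneq bc => ->; rewrite ltnn.
by right; apply: precedes_trans ca.
Qed.

Lemma perm_of_key (K : 'I_n -> nat) : injective K ->
  {s : 'S_n | forall x y, precedes s x y = (K x < K y)%N}.
Proof.
move=> Kinj; pose D x := [set z | (K z < K x)%N].
have ltD x y : (K x < K y)%N -> (#|D x| < #|D y|)%N.
  move=> xy; apply: proper_card; apply/properP; split.
    by apply/subsetP => z; rewrite !inE => zx; apply: ltn_trans xy.
  by exists x; rewrite inE ?ltnn.
have Dn x : (#|D x| < n)%N.
  have := ltD; have: D x \proper [set: 'I_n].
    by apply/properP; split; [apply: subsetT|exists x; rewrite !inE ?ltnn].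
  by move/proper_card; rewrite cardsT card_ord.
have rinj : injective (fun x => Ordinal (Dn x)).
  move=> x y [Dxy]; apply: Kinj; apply/eqP; rewrite eqn_leq.
  by apply/andP; split; rewrite leqNgt; apply/negP=> /ltD; rewrite Dxy ltnn.
exists (perm rinj)^-1%g => x y; rewrite /precedes /= invgK !permE /=.
apply/idP/idP=> [|/ltD//]; apply: contraTT; rewrite -!leqNgt leq_eqVlt.
by case/orP=> [/eqP/Kinj->//|/ltD/ltnW].
Qed.

Lemma perm_of_order (L : rel 'I_n) : irreflexive L -> transitive L ->
  (forall x y, x != y -> L x y || L y x) -> {s : 'S_n | precedes s =2 L}.
Proof.
move=> irr tr tot; pose K x := #|[set z | L z x]|.
have ltK x y : L x y -> (K x < K y)%N.
  move=> xy; apply: proper_card; apply/properP; split.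
    by apply/subsetP => z; rewrite !inE => zx; apply: tr xy.
  by exists x; rewrite inE ?irr.
have KE x y : (K x < K y)%N = L x y.
  apply/idP/idP=> [xy|/ltK//]; have ne : x != y by apply: contraTneq xy => ->; rewrite ltnn.
  case/orP: (tot x y ne) => // /ltK yx.
  by have := ltn_trans xy yx; rewrite ltnn.
have Kinj : injective K.
  move=> x y e; apply/eqP; apply/idPn => /tot.
  by rewrite -!KE e ltnn.
by have [s sE] := perm_of_key Kinj; exists s => x y; rewrite sE KE.
Qed.

Lemma reverse_perm s : {t : 'S_n | forall x y, precedes t x y = precedes s y x}.
Proof.
have [||x y ne|t tE] := @perm_of_order (fun x y => precedes s y x).
- exact: precedes_irr.
- by move=> y x z xy yz; apply: precedes_trans yz xy.
- by rewrite -precedesN ?orNb // eq_sym.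
by exists t => x y; rewrite tE.
Qed.

(** The inversions of the join are the transitive closure of the union of the
    two inversion sets: cotransitivity passes to the closure. *)
Lemma join_exists s t : {m | is_join s t m}.
Proof.
pose R := [rel x y : 'I_n | (y < x)%N && (precedes s x y || precedes t x y)].
have Rlt x y : connect R x y -> (y <= x)%N.
  case/connectP=> p; elim: p x => [|z p IHp] x /=; first by move=> _ ->.
  by case/andP=> /andP[zx _] pz yE; apply: leq_trans (IHp z pz yE) (ltnW zx).
have cotr a b c : (a < b)%N -> (b < c)%N -> connect R c a ->
    connect R c b || connect R b a.
  move=> ab bc ca; have nab : ~~ (b < a)%N by rewrite -leqNgt ltnW.
  have [u [v [uv bu nbv cu va]]] := @connect_exit _ _ (fun z : 'I_n => b < z)%N _ _ ca bc nab.
  case/andP: uv => vu Ruv; have [vb|vb] := eqVneq v b.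
    rewrite -vb; apply/orP; left; apply: connect_trans cu (connect1 _).
    by apply/andP.
  have {nbv} vb' : (v < b)%N by rewrite ltn_neqAle vb leqNgt.
  have: R u b || R b v.
    rewrite /= bu vb' /=; case/orP: Ruv => uv.
      have [//|] := boolP (precedes s u b); rewrite precedesN => [bu'|]; last first.
        by apply: contraTneq bu => ->; rewrite ltnn.
      by rewrite (precedes_trans bu' uv) orbT.
    have [/[!orbT]//|] := boolP (precedes t u b); rewrite precedesN => [bu'|]; last first.
      by apply: contraTneq bu => ->; rewrite ltnn.
    by rewrite (precedes_trans bu' uv) !orbT.
  case/orP=> [ub|bv']; apply/orP; [left|right].
      by apply: connect_trans cu _; apply: connect1.
  by apply: connect_trans va; apply: connect1.
(* The linear order whose inversions are the pairs related by the closure. *)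
pose L : rel 'I_n := [rel x y : 'I_n | if (y < x)%N then connect R x y
                     else (x < y)%N && ~~ connect R y x].
have [|||m mE] := @perm_of_order L.
- by move=> x; rewrite /L /= ltnn.
- move=> y x z; rewrite /L /=.
  have := @connect_trans _ R; have := cotr.
  case: (ltngtP x y) => [xy|yx|/val_inj->//]; case: (ltngtP y z) => [yz|zy|/val_inj->//] //= ct tr.
  + rewrite ltnNge (ltnW (ltn_trans xy yz)) (ltn_trans xy yz) /= => nyx nzy.
    apply/negP=> /(ct _ _ _ xy yz)/orP[zy|yx]; first by rewrite zy in nzy.
    by rewrite yx in nyx.
  + move=> nyx yz; case: (ltngtP x z) => [xz|zx|/val_inj xz] /=.
    * by apply/negP=> zx; rewrite (tr _ _ _ yz zx) in nyx.
    * by case/orP: (ct _ _ _ zx xy yz) => // yx; rewrite yx in nyx.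
    * by rewrite xz yz in nyx.
  + move=> xy nzy; case: (ltngtP x z) => [xz|zx|/val_inj xz] /=.
    * by apply/negP=> zx; rewrite (tr _ _ _ zx xy) in nzy.
    * by case/orP: (ct _ _ _ yz zx xy) => // zy; rewrite zy in nzy.
    * by rewrite -xz xy in nzy.
  + by move=> xy yz; rewrite (ltn_trans zy yx); apply: tr yz.
- move=> x y; rewrite /L /=; case: (ltngtP x y) => [_|_|/val_inj->] //=; last by rewrite eqxx.
    by rewrite orNb.
  by rewrite orbN.
have mI c a : ((c, a) \in inversions m) = (a < c)%N && connect R c a.
  by rewrite mem_inv mE /L /=; case: ltngtP.
exists m; split.
- apply/weak_leP => c a; rewrite mI mem_inv => /andP[ac ca]; rewrite ac.
  by apply: connect1; rewrite /= ac ca.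
- apply/weak_leP => c a; rewrite mI mem_inv => /andP[ac ca]; rewrite ac.
  by apply: connect1; rewrite /= ac ca orbT.
move=> u /weak_leP su /weak_leP tu; apply/weak_leP => c a.
rewrite mI => /andP[+ /connectP[p]].
elim: p c => [|z p IHp] c /=; first by move=> + _ e; rewrite e ltnn.
move=> ac /andP[/andP[zc Rcz] pz aE].
have cz : (c, z) \in inversions u.
  by case/orP: Rcz => cz; [apply: su|apply: tu]; rewrite mem_inv zc.
have [az|za] := ltnP a z; first exact: inv_trans cz (IHp z az pz aE).
suff -> : a = z by [].
by apply: val_inj; apply/eqP; rewrite eqn_leq za Rlt //; apply/connectP; exists p.
Qed.

Lemma weak_le_reverse s t s' t' : (forall x y, precedes s' x y = precedes s y x) ->
  (forall x y, precedes t' x y = precedes t y x) -> weak_le s t -> weak_le t' s'.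
Proof.
move=> sE tE /weak_leP st; apply/weak_leP => c a; rewrite !mem_inv sE tE.
case/andP=> ac ca; rewrite ac; have ne : a != c by apply: contraTneq ac => ->; rewrite ltnn.
rewrite -precedesN 1?eq_sym //; apply/negP=> ca'.
have := st c a; rewrite !mem_inv ac ca' => /(_ isT) /=.
by rewrite -/(precedes t c a); apply/negP; rewrite precedesN // eq_sym.
Qed.

Lemma meet_exists s t : {m | is_meet s t m}.
Proof.
have [s' s'E] := reverse_perm s; have [t' t'E] := reverse_perm t.
have [m' [sm tm mmin]] := join_exists s' t'.
have [m mE] := reverse_perm m'.
have m'E x y : precedes m' x y = precedes m y x by rewrite mE.
have sE x y : precedes s x y = precedes s' y x by rewrite s'E.
have tE x y : precedes t x y = precedes t' y x by rewrite t'E.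
exists m; split; [exact: weak_le_reverse sm|exact: weak_le_reverse tm|].
move=> u us ut; have [u' u'E] := reverse_perm u.
have uE x y : precedes u x y = precedes u' y x by rewrite u'E.
apply: (weak_le_reverse mE uE) => //; apply: mmin.
  exact: weak_le_reverse us.
exact: weak_le_reverse ut.
Qed.

End Permutations.

(** * Permutations arranged in blocks *)

Section Arrangements.
Variable n : nat.
Implicit Types (s t u m : 'S_n) (x y a b c : 'I_n) (I : pred 'I_n) (l : seq 'I_n).

(** A cover relation of the weak order: [s'] is [s] with the adjacent values
    [a] and [c] exchanged. *)
Definition raises s s' c a : Prop :=
  [/\ (a < c)%N, (c, a) \notin inversions s & inversions s' = (c, a) |: inversions s].

Definition block I l x : nat := if I x then 0%N else (index x l).+1.

Lemma arrange_exists I l t :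
  {s : 'S_n | forall x y, precedes s x y =
     (block I l x < block I l y)%N || (block I l x == block I l y) && precedes t x y}.
Proof.
(* A lexicographic key: the block first, then the position in [t]. *)
pose K x := (block I l x * n + (t^-1)%g x)%N.
have divK x : (K x %/ n = block I l x)%N.
  by rewrite /K divnMDl ?(leq_ltn_trans _ (ltn_ord x)) // divn_small ?addn0 ?ltn_ord.
have modK x : (K x %% n = (t^-1)%g x)%N by rewrite /K modnMDl modn_small ?ltn_ord.
have [|s sE] := @perm_of_key n K.
  by move=> x y e; apply: (@perm_inj _ (t^-1)%g); apply: val_inj; rewrite /= -!modK e.
exists s => x y; rewrite sE /K /precedes /=.
have := (ltn_ord ((t^-1)%g x)); have := (ltn_ord ((t^-1)%g y)).
move: (val ((t^-1)%g x)) (val ((t^-1)%g y)) (block I l x) (block I l y) => p q f g /= qn pn.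
case: (ltngtP f g) => [fg|gf|->] /=.
- have : (f * n + n <= g * n)%N by rewrite -mulSnr leq_mul2r fg orbT.
  by clear -pn; lia.
- have : (g * n + n <= f * n)%N by rewrite -mulSnr leq_mul2r gf orbT.
  by clear -qn; lia.
- by rewrite ltn_add2l.
Qed.

(** The values of [I] come first, then the letters of [l] in the order of [l],
    then the remaining values; [t] orders the first and the last block. The
    permutation of an arc, the linear extensions in which two given values are
    consecutive, and the permutations of three consecutive letters are all of
    this form. *)
Definition arrange I l t : 'S_n := sval (arrange_exists I l t).

Lemma precedes_arrange I l t x y : precedes (arrange I l t) x y =
  (block I l x < block I l y)%N || (block I l x == block I l y) && precedes t x y.
Proof. by rewrite /arrange; case: arrange_exists. Qed.

Lemma arrange_in I l t x y : I x -> ~~ I y -> precedes (arrange I l t) x y.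
Proof. by move=> Ix Iy; rewrite precedes_arrange /block Ix (negbTE Iy). Qed.

Lemma arrange_index I l t x y : ~~ I x -> ~~ I y -> (index x l < index y l)%N ->
  precedes (arrange I l t) x y.
Proof. by move=> Ix Iy xy; rewrite precedes_arrange /block (negbTE Ix) (negbTE Iy) ltnS xy. Qed.

Lemma arrange_out I l t x y : x \in l -> y \notin l -> ~~ I x -> ~~ I y ->
  precedes (arrange I l t) x y.
Proof.
move=> xl yl Ix Iy; apply: arrange_index => //.
by rewrite (memNindex yl) index_mem.
Qed.

Lemma block_swap I l1 l2 x y z : z != x -> z != y ->
  block I (l1 ++ y :: x :: l2) z = block I (l1 ++ x :: y :: l2) z /\
  ((block I (l1 ++ x :: y :: l2) z <= size l1) ||
   ((size l1).+2 < block I (l1 ++ x :: y :: l2) z))%N.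
Proof.
move=> zx zy; rewrite /block; case: ifP => // _; rewrite !index_cat.
have [zl|_] := boolP (z \in l1); first by rewrite index_mem zl.
by rewrite /= ![_ == z]eq_sym (negbTE zx) (negbTE zy); split=> //; clear; lia.
Qed.

Lemma arrange_raises I l1 l2 t x y : uniq (l1 ++ x :: y :: l2) -> ~~ I x -> ~~ I y ->
  (x < y)%N ->
  raises (arrange I (l1 ++ x :: y :: l2) t) (arrange I (l1 ++ y :: x :: l2) t) y x.
Proof.
rewrite cat_uniq => /and3P[_ /norP[xl /norP[yl _]] /andP[]].
rewrite inE negb_or => /andP[ne _] _ Ix Iy xy.
have bx z w : z \notin l1 -> ~~ I z -> block I (l1 ++ z :: w) z = (size l1).+1.
  by move=> zl Iz; rewrite /block (negbTE Iz) index_cat (negbTE zl) /= eqxx addn0.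
have by' z w v : z \notin l1 -> ~~ I z -> v != z ->
    block I (l1 ++ v :: z :: w) z = (size l1).+2.
  by move=> zl Iz vz; rewrite /block (negbTE Iz) index_cat (negbTE zl) /= (negbTE vz) eqxx addn1.
have [Ex Ey] := (bx x (y :: l2) xl Ix, by' y l2 x yl Iy ne).
have ne2 : y != x by rewrite eq_sym.
have [Ey' Ex'] := (bx y (x :: l2) yl Iy, by' x l2 y xl Ix ne2).
split=> //; first by rewrite mem_inv xy precedes_arrange Ex Ey; clear; lia.
apply/setP => -[d b]; rewrite in_setU1 !mem_inv.
case: ltnP => bd /=; last first.
  rewrite orbF; apply/esym/eqP => -[dE bE]; by rewrite dE bE leqNgt xy in bd.
rewrite !precedes_arrange xpair_eqE.
have swp z := @block_swap I l1 l2 x y z.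
move: bd; rewrite ltn_neqAle => /andP[ne' bd].
have [dE|dx] := eqVneq d x; have [bE|bx'] := eqVneq b x.
- by rewrite dE bE eqxx in ne'.
- rewrite dE (negbTE ne) /= Ex Ex'.
  have [bE|by''] := eqVneq b y; first by move: bd; rewrite dE bE leqNgt xy.
  by have [-> H] := swp b bx' by''; move: H; clear; case: (precedes t x b); lia.
- rewrite bE Ex Ex' andbT; have [dE|dy] := eqVneq d y; first by rewrite dE Ey'; clear; lia.
  by have [-> H] := swp d dx dy; move: H; clear; case: (precedes t d x); lia.
rewrite andbF /=; have [dE|dy] := eqVneq d y; have [bE|by''] := eqVneq b y.
- by rewrite dE bE eqxx in ne'.
- rewrite dE Ey Ey'; have [-> H] := swp b bx' by''; move: H; clear; case: (precedes t y b); lia.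
- rewrite bE Ey Ey'; have [-> H] := swp d dx dy; move: H; clear; case: (precedes t d y); lia.
by have [-> _] := swp d dx dy; have [-> _] := swp b bx' by''.
Qed.

End Arrangements.

(** * Lattice congruences: intervals and forced contractions *)

Section Congruence.
Variables (n : nat) (e : rel 'S_n).
Hypothesis econ : lattice_congruence e.
Implicit Types (s t u m : 'S_n) (x y a b c : 'I_n).

Lemma cong_refl : reflexive e.
Proof. by case: econ => eq _ _ x; case: (eq x x x). Qed.

Lemma cong_sym : symmetric e.
Proof. by case: econ => /equivalence_relP[er elt] _ _ x y; apply/idP/idP=> /elt <-; apply: er. Qed.

Lemma cong_trans : transitive e.
Proof. by case: econ => /equivalence_relP[er elt] _ _ y x z /elt->. Qed.

Lemma cong_meet s s' t m m' : e s s' -> is_meet s t m -> is_meet s' t m' -> e m m'.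
Proof. by case: econ => _ H _ es; apply: H es (cong_refl t). Qed.

Lemma cong_join s s' t m m' : e s s' -> is_join s t m -> is_join s' t m' -> e m m'.
Proof. by case: econ => _ _ H es; apply: H es (cong_refl t). Qed.

Lemma weak_le_trans s t u : weak_le s t -> weak_le t u -> weak_le s u.
Proof. exact: subset_trans. Qed.

Lemma is_join_le s t : weak_le s t -> is_join s t t.
Proof. by move=> st; split; rewrite ?weak_le_refl. Qed.

Lemma is_meet_le s t : weak_le s t -> is_meet t s s.
Proof. by move=> st; split; rewrite ?weak_le_refl. Qed.

Lemma is_joinC s t m : is_join s t m -> is_join t s m.
Proof. by case=> sm tm H; split=> // u tu su; apply: H. Qed.

Lemma is_meetC s t m : is_meet s t m -> is_meet t s m.
Proof. by case=> sm tm H; split=> // u tu su; apply: H. Qed.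

Lemma cong_convex s t u : weak_le s t -> weak_le t u -> e s u -> e s t.
Proof.
move=> st tu esu; apply: (cong_trans esu); rewrite cong_sym.
exact: (cong_join esu (is_join_le st) (is_joinC (is_join_le tu))).
Qed.

Lemma weak_le_card s t : weak_le s t -> (#|inversions t| <= #|inversions s|)%N ->
  weak_le t s.
Proof.
move=> st ts; have /eqP := eqEcard (inversions s) (inversions t).
by rewrite -/(weak_le s t) st ts /= /weak_le => /eqP/eqP->.
Qed.

(** A member with the fewest inversions equals its meet with any other. *)
Lemma class_has_min s : exists2 m, e s m & class_min e m.
Proof.
case: (arg_minnP (fun m => #|inversions m|) (cong_refl s)) => m em mmin.
exists m => //; apply/forallP => t; apply/implyP => emt.
have [p pP] := meet_exists m t.
have epm : e p m.
  have emm : e t m by rewrite cong_sym.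
  exact: (cong_meet emm (is_meetC pP) (is_meet_le (weak_le_refl m))).
have [pm pt _] := pP; apply: weak_le_trans pt; apply: weak_le_card pm (mmin p _).
by apply: cong_trans em _; rewrite cong_sym.
Qed.

Lemma class_has_max s : exists2 m, e s m & forall t, e m t -> weak_le t m.
Proof.
case: (arg_maxnP (fun m => #|inversions m|) (cong_refl s)) => m em mmax.
exists m => // t emt; have [p pP] := join_exists m t.
have epm : e p m.
  have emm : e t m by rewrite cong_sym.
  exact: (cong_join emm (is_joinC pP) (is_join_le (weak_le_refl m))).
have [mp tp _] := pP; apply: (weak_le_trans tp); apply: weak_le_card mp (mmax p _).
by apply: cong_trans em _; rewrite cong_sym.
Qed.

Lemma raises_le s s' c a : raises s s' c a -> weak_le s s'.
Proof. by case=> _ _ E; rewrite /weak_le E subsetUr. Qed.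

Lemma raises_precedes s s' c a : raises s s' c a ->
  precedes s a c /\ precedes s' c a.
Proof.
case=> ac nca E; have ne : c != a by apply: contraTneq ac => ->; rewrite ltnn.
have : (c, a) \in inversions s' by rewrite E setU11.
rewrite mem_inv => /andP[_ ca]; split=> //.
by move: nca; rewrite mem_inv ac /= precedesN.
Qed.

(** Joining the first cover with [t0], or meeting the second one with [s1],
    yields the other: a congruence contracts both or neither. *)
Lemma cong_perspective s0 s1 t0 t1 c a : raises s0 s1 c a -> raises t0 t1 c a ->
  weak_le s0 t0 -> e s0 s1 = e t0 t1.
Proof.
move=> [ac ns0 E1] [_ nt0 F1] st.
have s1t1 : weak_le s1 t1 by rewrite /weak_le E1 F1 setUS.
have s0s1 : weak_le s0 s1 by rewrite /weak_le E1 subsetUr.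
have t0t1 : weak_le t0 t1 by rewrite /weak_le F1 subsetUr.
apply/idP/idP=> H.
  have J : is_join s1 t0 t1.
    split=> // u; rewrite /weak_le E1 F1 !subUset => /andP[-> _] ->.
    by [].
  exact: (cong_join H (is_join_le st) J).
have M : is_meet t0 s1 s0.
  split=> // u /weak_leP ut; rewrite /weak_le E1 => us.
  apply/subsetP => -[x y] xyu; have := subsetP us _ xyu.
  by rewrite in_setU1 => /orP[/eqP xyE|//]; rewrite -xyE ut in nt0.
exact: (cong_meet H M (is_meet_le s1t1)).
Qed.

(** Contracting the edge from [s0] to [s] of a hexagon contracts, by joining
    with [w], the opposite chain from [w] to the top; the cover of [w] that adds
    the inversion [(c, a)] lies on this chain because [(c, b)] and [(b, a)]
    generate [(c, a)]. *)
Lemma force_join s0 s w t a b c : e s0 s -> weak_le s0 s -> weak_le s0 w ->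
  raises w t c a ->
  (c, b) \in inversions s :|: inversions w -> (b, a) \in inversions s :|: inversions w -> e w t.
Proof.
move=> es s0s s0w [ac _ E] cb ba; have [m mP] := join_exists s w.
have [/weak_leP sm /weak_leP wm _] := mP.
have ewm : e w m := cong_join es (is_join_le s0w) mP.
have inm x y : (x, y) \in inversions s :|: inversions w -> (x, y) \in inversions m.
  by case/setUP => [/sm|/wm].
apply: cong_convex ewm; first by rewrite /weak_le E subsetUr.
rewrite /weak_le E subUset sub1set (inv_trans (inm _ _ cb) (inm _ _ ba)) /=.
by apply/weak_leP.
Qed.

(** Dually, contracting an edge at the top of a hexagon contracts the opposite
    chain down from [w]. *)
Lemma force_meet s1 s w t a b c : e s1 s -> weak_le s1 s -> weak_le w s ->
  raises t w c a -> (a < b < c)%N ->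
  (c, b) \notin inversions s1 :&: inversions w -> (b, a) \notin inversions s1 :&: inversions w ->
  e t w.
Proof.
move=> es s1s ws [ac _ E] /andP[ab bc] cb ba; have [m mP] := meet_exists s1 w.
have [/weak_leP ms /weak_leP mw _] := mP.
have emw : e m w := cong_meet es mP (is_meet_le ws).
have inm x y : (x, y) \in inversions m -> (x, y) \in inversions s1 :&: inversions w.
  by move=> xy; rewrite inE ms ?mw.
have mt : weak_le m t.
  apply/weak_leP => x y xy; have := mw x y xy.
  rewrite E in_setU1 => /orP[/eqP[xc ya]|//]; rewrite xc ya in xy.
  by case: (inv_cotrans ab bc xy) => /inm H; rewrite H in cb ba.
have tw : weak_le t w by rewrite /weak_le E subsetUr.
by have := cong_convex mt tw emw; rewrite cong_sym => /cong_trans; apply.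
Qed.

End Congruence.

(** * The permutation of an arc *)

Section ArcPerm.
Variable n : nat.
Implicit Types (s t m : 'S_n) (x y u v : 'I_n) (a b : quad n).

Lemma precedes1 x y : precedes 1%g x y = (x < y)%N.
Proof. by rewrite /precedes /= invg1 !perm1. Qed.

Lemma precedes_one_line s x y :
  precedes s x y = (index x (one_line s) < index y (one_line s))%N.
Proof.
have idx z : index z (one_line s) = (s^-1)%g z.
  rewrite -{1}(permKV s z) /one_line index_map; last exact: perm_inj.
  by rewrite index_enum_ord.
by rewrite /precedes /= !idx.
Qed.

Lemma enum_pairwise (A : {set 'I_n}) : pairwise (fun x y => x < y)%N (enum A).
Proof.
rewrite /enum_mem; apply: pairwise_filter.
have : pairwise ltn (map val (enum 'I_n)).
  by rewrite val_enum_ord -(sorted_pairwise ltn_trans) iota_ltn_sorted.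
by rewrite pairwise_map enumT.
Qed.

Definition before_arc a : pred 'I_n := fun k => (k < qi a)%N || (k \in qA a).

Lemma arc_lt a : is_arc a -> (qi a < qj a)%N.
Proof. by case/and3P. Qed.

Lemma arc_mem a x : is_arc a ->
  (x \in qA a) || (x \in qB a) = (qi a < x < qj a)%N.
Proof. by case/and3P=> _ /eqP AB _; rewrite -in_setU AB inE. Qed.

Lemma arc_disj a x : is_arc a -> x \in qA a -> x \in qB a -> False.
Proof. by case/and3P=> _ _ /pred0P/(_ x) /= + xA xB; rewrite xA xB. Qed.

Lemma before_arcNj a : is_arc a -> ~~ before_arc a (qj a).
Proof.
move=> ar; have := arc_mem (qj a) ar; rewrite /before_arc ltnn andbF.
by case: (_ \in _) => //= _; rewrite orbF -leqNgt ltnW // arc_lt.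
Qed.

Lemma before_arcNi a : is_arc a -> ~~ before_arc a (qi a).
Proof.
move=> ar; have := arc_mem (qi a) ar; rewrite /before_arc !ltnn /=.
by case: (_ \in _).
Qed.

(** Both blocks of the word of an arc around its descent are increasing,
    because the values below [qi a] are smaller than those of [qA a] and the
    values above [qj a] are larger than those of [qB a]. *)
Lemma precedes_arc_perm a x y : is_arc a ->
  precedes (arc_perm a) x y = precedes (arrange (before_arc a) [:: qj a; qi a] 1%g) x y.
Proof.
move=> ar; set r := precedes (arrange _ _ _).
have ij := arc_lt ar.
have pw : pairwise r (arc_word a).
  have rI u v : before_arc a u -> before_arc a v -> (u < v)%N -> r u v.
    by move=> Iu Iv uv; rewrite /r precedes_arrange /block Iu Iv precedes1 uv.
  have rO u v : ~~ before_arc a u -> ~~ before_arc a v -> u \notin [:: qj a; qi a] ->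
      v \notin [:: qj a; qi a] -> (u < v)%N -> r u v.
    move=> Iu Iv ul vl uv; rewrite /r precedes_arrange /block (negbTE Iu) (negbTE Iv).
    by rewrite (memNindex ul) (memNindex vl) eqxx precedes1 uv orbT.
  have sub (A : {set 'I_n}) :
      {in A &, forall u v : 'I_n, (u < v)%N -> r u v} -> pairwise r (enum A).
    move=> H; apply: (@sub_in_pairwise _ (mem A) (fun x y => x < y)%N).
    - by move=> u v uA vA; apply: H.
    - by apply/allP => z; rewrite mem_enum.
    - exact: enum_pairwise.
  have I1 u : u \in [set k : 'I_n | (k < qi a)%N] -> before_arc a u.
    by rewrite inE /before_arc => ->.
  have I2 u : u \in qA a -> before_arc a u by rewrite /before_arc => ->; rewrite orbT.
  have O1 u : u \in qB a -> ~~ before_arc a u /\ u \notin [:: qj a; qi a].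
    move=> uB; have := arc_mem u ar; rewrite uB orbT => /esym/andP[iu uj].
    split; first by apply/norP; split; [rewrite -leqNgt ltnW|apply/negP=> /(arc_disj ar)/(_ uB)].
    by rewrite !inE negb_or -!val_eqE /= neq_ltn uj neq_ltn iu !orbT.
  have O2 u : u \in [set k : 'I_n | (qj a < k)%N] -> ~~ before_arc a u /\ u \notin [:: qj a; qi a].
    rewrite inE => ju; have iu := ltn_trans ij ju; split; last first.
      by rewrite !inE negb_or -!val_eqE /= neq_ltn ju neq_ltn iu !orbT.
    apply/norP; split; first by rewrite -leqNgt ltnW.
    by have := arc_mem u ar; rewrite (ltnNge u) (ltnW ju) andbF; case: (u \in qA a).
  have Ij := before_arcNj ar; have Ii := before_arcNi ar.
  have IO u v : before_arc a u -> ~~ before_arc a v -> r u v by apply: arrange_in.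
  have ji : r (qj a) (qi a).
    apply: arrange_index => //=; rewrite eqxx; case: eqP => [jE|]; rewrite ?eqxx //.
    by rewrite jE ltnn in ij.
  have lO u v : u \in [:: qj a; qi a] -> v \notin [:: qj a; qi a] -> ~~ before_arc a v -> r u v.
    move=> ul vl Iv; apply: arrange_out => //.
    by move: ul; rewrite !inE => /orP[/eqP->|/eqP->].
  have lI u v : before_arc a u -> v \in [:: qj a; qi a] -> r u v.
    by move=> Iu; rewrite !inE => /orP[/eqP->|/eqP->]; apply: IO.
  have O3 u v : before_arc a u -> v \in qB a -> r u v by move=> Iu /O1[Iv _]; apply: IO.
  have O4 u v : before_arc a u -> v \in [set k : 'I_n | (qj a < k)%N] -> r u v.
    by move=> Iu /O2[Iv _]; apply: IO.
  have al (X Y : seq 'I_n) : (forall u v, u \in X -> v \in Y -> r u v) -> allrel r X Y.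
    by move=> H; apply/allrelP.
  have pL : pairwise r [:: qj a; qi a] by rewrite /= ji.
  have pB : pairwise r (enum (qB a)) by apply: sub => u v /O1[Iu ul] /O1[Iv vl]; apply: rO.
  have pA : pairwise r (enum (qA a)).
    by apply: sub => u v /I2 Iu /I2 Iv; apply: rI.
  rewrite /arc_word !pairwise_cat !allrel_catr pL pA pB !sub; first last.
  - by move=> u v /I1 Iu /I1 Iv; apply: rI.
  - by move=> u v /O2[Iu ul] /O2[Iv vl]; apply: rO.
  rewrite !al // => u v; rewrite ?mem_enum.
  - move=> u3 v4; have [Iu ul] := O1 u u3; have [Iv vl] := O2 v v4; apply: rO => //.
    have := arc_mem u ar; rewrite u3 orbT => /esym/andP[_ uj].
    by move: v4; rewrite inE; apply: ltn_trans.
  - by move=> ul /O2[Iv vl]; apply: lO.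
  - by move=> ul /O1[Iv vl]; apply: lO.
  - by move/I2/O4; apply.
  - by move/I2/O3; apply.
  - by move/I2/lI; apply.
  - by move/I1/O4; apply.
  - by move/I1/O3; apply.
  - by move/I1/lI; apply.
  - move=> u1 v2; apply: (rI u v (I1 _ u1) (I2 _ v2)).
    have := arc_mem v ar; rewrite v2 => /esym/andP[iv _].
    by move: u1; rewrite inE => ui; apply: ltn_trans iv.
have winw z : z \in arc_word a by rewrite (perm_mem (arc_word_perm ar)) mem_enum.
have rw u v : (index u (arc_word a) < index v (arc_word a))%N -> r u v.
  move=> uv; have /(pairwiseP u) := pw.
  move=> /(_ (index u (arc_word a)) (index v (arc_word a))).
  by rewrite !inE !index_mem !nth_index //; apply.
rewrite precedes_one_line one_line_arc_perm //; apply/idP/idP => [|rxy]; first exact: rw.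
case: ltngtP => //; first by move/rw=> ryx; have := precedes_asym rxy; rewrite -/r ryx.
move/(congr1 (nth x (arc_word a))); rewrite !nth_index // => xy.
by move: rxy; rewrite xy /r precedes_irr.
Qed.

End ArcPerm.

(** * Covers of the weak order and arcs *)

Section Contraction.
Variables (n : nat) (e : rel 'S_n).
Hypothesis econ : lattice_congruence e.
Implicit Types (s t m : 'S_n) (x y u v : 'I_n) (a b : quad n).

(** The unique element covered by the join-irreducible [arc_perm a]. *)
Definition arc_perm0 a : 'S_n := arrange (before_arc a) [:: qi a; qj a] 1%g.

Lemma arc_perm_raises a : is_arc a -> raises (arc_perm0 a) (arc_perm a) (qj a) (qi a).
Proof.
move=> ar; have ij := arc_lt ar.
have := @arrange_raises n (before_arc a) [::] [::] 1%g (qi a) (qj a).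
rewrite /= inE andbT -val_eqE /= neq_ltn ij /=.
move=> /(_ isT (before_arcNi ar) (before_arcNj ar) isT) [_ nin E]; split=> //.
by rewrite -E; apply/setP => -[x y]; rewrite !mem_inv precedes_arc_perm.
Qed.

Lemma inv_arc_perm0 a x y : is_arc a -> (x, y) \in inversions (arc_perm0 a) ->
  ((x \in qA a) || (x == qj a)) && ((y \in qB a) || (y == qi a)).
Proof.
move=> ar; rewrite mem_inv precedes_arrange precedes1 => /andP[yx].
have -> : (x < y)%N = false by rewrite ltnNge (ltnW yx).
rewrite andbF orbF.
have ij := arc_lt ar; have Ax := arc_mem x ar; have Ay := arc_mem y ar.
rewrite /block {1 2}/before_arc /= ![qi a == _]eq_sym ![qj a == _]eq_sym.
case: (ltnP x (qi a)) => xi /=; first by rewrite (ltn_trans yx xi).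
case: (ltnP y (qi a)) => yi /=; first by case: ifP.
case: (boolP (x \in qA a)) Ax => xA /=.
  move=> /esym/andP[_ xj]; have yj := ltn_trans yx xj.
  move: Ay; rewrite yj andbT; case: (boolP (y \in qA a)) => //= _ Ay _.
  by move: Ay; rewrite -val_eqE [RHS]ltn_neqAle yi andbT eq_sym;
    case: (y \in qB a) => //=; case: eqP.
move=> _; case: (boolP (y \in qA a)) Ay => //= yA Ay.
case: (boolP (x == qi a)) => [/eqP xE|xNi] /=; first by rewrite xE ltnNge yi in yx.
case: (boolP (x == qj a)) => [/eqP xE|xNj] /= H.
  have yj : (y < qj a)%N by rewrite -xE.
  by move: Ay; rewrite yj andbT -val_eqE [RHS]ltn_neqAle yi andbT eq_sym;
    case: (y \in qB a) => //=; case: eqP.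
by move: H; clear; case: (y == qi a) => //; case: (y == qj a).
Qed.

Lemma inv_arc_perm a x y : is_arc a -> (x, y) \in inversions (arc_perm a) ->
  ((x \in qA a) || (x == qj a)) && ((y \in qB a) || (y == qi a)).
Proof.
move=> ar; have [_ _ ->] := arc_perm_raises ar; rewrite in_setU1.
case/orP=> [/eqP[-> ->]|]; last exact: inv_arc_perm0.
by rewrite !eqxx !orbT.
Qed.

(** By cotransitivity, the inversion [(qj a, qi a)] already forces all the
    other inversions of [arc_perm a], so an element below [arc_perm a] that has
    it is [arc_perm a] itself. *)
Lemma arc_perm_irreducible a m : is_arc a -> weak_le m (arc_perm a) ->
  (qj a, qi a) \in inversions m -> weak_le (arc_perm a) m.
Proof.
move=> ar /weak_leP mle ji; apply/weak_leP => x y xy.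
have yx : (y < x)%N by move: xy; rewrite mem_inv => /andP[].
have /andP[xA yB] := inv_arc_perm ar xy.
have nA u v : u \in qA a -> (v, u) \in inversions (arc_perm a) -> v <> qj a.
  move=> uA; rewrite mem_inv precedes_arc_perm // => /andP[_] + vE; apply/negP.
  rewrite vE; apply: precedes_asym; apply: arrange_in (before_arcNj ar).
  by rewrite /before_arc uA orbT.
have xi : (x, qi a) \in inversions m.
  case/orP: xA => [xA|/eqP-> //].
  have := arc_mem x ar; rewrite xA => /esym/andP[ix xj].
  by case: (inv_cotrans ix xj ji) => // /mle/(nA _ _ xA).
case/orP: yB => [yB|/eqP-> //].
have := arc_mem y ar; rewrite yB orbT => /esym/andP[iy yj].
case: (inv_cotrans iy yx xi) => // /mle.
rewrite mem_inv precedes_arc_perm // => /andP[_ /precedes_asym/negP[]].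
apply: arrange_out (before_arcNi ar) _.
- by rewrite !inE eqxx orbT.
- by rewrite !inE negb_or -!val_eqE /= neq_ltn yj neq_ltn iy orbT.
by apply/norP; split; [rewrite -leqNgt ltnW|apply/negP=> /(arc_disj ar)/(_ yB)].
Qed.

(** The cover from [s] to [s'] is perspective to the one from [arc_perm0 a] to
    [arc_perm a], and a join-irreducible is the minimum of its class exactly
    when it is not congruent to the element that it covers. *)
Lemma arc_contracted a s s' : is_arc a -> raises s s' (qj a) (qi a) ->
  (forall k, k \in qA a -> precedes s k (qi a)) ->
  (forall k, k \in qB a -> precedes s (qj a) k) ->
  e s s' = ~~ arcs_of e a.
Proof.
move=> ar rs sA sB; have r0 := arc_perm_raises ar.
have [ij' _] := raises_precedes rs.
have le0 : weak_le (arc_perm0 a) s.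
  apply/weak_leP => x y xy; have := inv_arc_perm0 ar xy.
  have yx : (y < x)%N by move: xy; rewrite mem_inv => /andP[].
  rewrite mem_inv yx /= => /andP[/orP[/sA xi|/eqP xE] /orP[/sB jy|/eqP yE]].
  - by apply: precedes_trans jy; apply: precedes_trans ij'.
  - by rewrite yE.
  - by rewrite xE.
  - by case: r0 => _ + _; rewrite -xE -yE xy.
rewrite -(cong_perspective econ r0 rs le0) /arcs_of ar /=.
have [ac nin E] := r0; apply/idP/idP => [H|].
  apply/negP=> /forallP/(_ (arc_perm0 a)); rewrite (cong_sym econ) H /=.
  by move/weak_leP => /(_ _ _ (_ : (qj a, qi a) \in _)); rewrite (negbTE nin) E setU11 => /(_ isT).
apply: contraR => ne; apply/forallP => t; apply/implyP => et.
have [m em mmin] := class_has_min econ (arc_perm a).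
have emt t' : e (arc_perm a) t' -> weak_le m t'.
  move=> et'; apply: (implyP (forallP mmin t')); apply: (cong_trans econ) et'.
  by rewrite (cong_sym econ).
have mle := emt _ (cong_refl econ _).
have [ji|nji] := boolP ((qj a, qi a) \in inversions m).
  exact: weak_le_trans (arc_perm_irreducible ar mle ji) (emt t et).
case/negP: ne; have m0 : weak_le m (arc_perm0 a).
  apply/weak_leP => x y xy; have /weak_leP/(_ _ _ xy) := mle.
  by rewrite E in_setU1 => /orP[/eqP xyE|//]; rewrite -xyE xy in nji.
have ema : e m (arc_perm a) by rewrite (cong_sym econ).
have := cong_convex econ m0 (raises_le r0) ema.
rewrite (cong_sym econ) => /(cong_trans econ); apply.
by [].
Qed.

End Contraction.

(** * Missing arcs and walls *)

Section Restriction.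
Variable n : nat.
Implicit Types (x y i k : 'I_n) (a b : quad n).

(** The subarc of [a] with ends [i] and [k]. *)
Definition restr a i k : quad n := Quad i k (qA a :&: oint i k) (qB a :&: oint i k).

Lemma is_arc_restr a i k : is_arc a -> (qi a <= i)%N -> (i < k)%N ->
  (k <= qj a)%N -> is_arc (restr a i k).
Proof.
case/and3P=> ij /eqP AB dAB ai ik kj; apply/and3P; split=> //=.
  rewrite -setIUl AB; apply/eqP/setIidPr/subsetP => z; rewrite !inE => /andP[iz zk].
  by rewrite (leq_ltn_trans ai iz) (leq_trans zk kj).
by apply: disjointWl (subsetIl _ _) _; apply: disjointWr (subsetIl _ _) dAB.
Qed.

Lemma arc_restr_sub a b : is_arc a -> is_arc b -> qA b \subset qA a ->
  qB b \subset qB a -> b = restr a (qi b) (qj b).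
Proof.
move=> aa ba AA BB; case: b => i k A B /= in ba AA BB *.
have bm z := arc_mem z ba; rewrite /= in bm.
congr Quad; apply/setP => z; rewrite !inE -bm.
- have [zA|zA] := boolP (z \in A); first by rewrite (subsetP AA).
  case: (boolP (z \in B)) => [zB|]; rewrite ?andbF // andbT.
  by apply/esym/negbTE/negP => /(arc_disj aa); apply; apply: (subsetP BB).
- have [zB|zB] := boolP (z \in B); first by rewrite (subsetP BB) // orbT.
  case: (boolP (z \in A)) => [zA|]; rewrite ?andbF // andbT.
  by apply/esym/negbTE/negP => /(arc_disj aa); apply; apply: (subsetP AA).
Qed.

Lemma restr_id a : is_arc a -> restr a (qi a) (qj a) = a.
Proof. by move=> aa; rewrite -arc_restr_sub. Qed.

Lemma restr_restr a i k i' k' : (i <= i')%N -> (k' <= k)%N ->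
  restr (restr a i k) i' k' = restr a i' k'.
Proof.
move=> ii kk; rewrite /restr /=; congr Quad; rewrite -setIA; congr (_ :&: _);
  by apply/setIidPr/subsetP => z; rewrite !inE => /andP[iz zk];
     rewrite (leq_ltn_trans ii iz) (leq_trans zk kk).
Qed.

End Restriction.

Section Forcing.
Variables (n : nat) (e : rel 'S_n).
Hypothesis econ : lattice_congruence e.
Implicit Types (s t m : 'S_n) (x y u v i k : 'I_n) (a b : quad n).

Section Step.
Variables (a : quad n) (x : 'I_n).
Hypotheses (ar : is_arc a) (xi : (qi a < x)%N) (xj : (x < qj a)%N).

(* As one of the three letters, [x] is removed from the values before them. *)
Let I0 : pred 'I_n := fun k => before_arc a k && (k != x).
Let L := [:: qi a; x; qj a].

Let ix : (qi a == x) = false. Proof. by rewrite -val_eqE ltn_eqF. Qed.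
Let xi' : (x == qi a) = false. Proof. by rewrite eq_sym. Qed.
Let xj' : (x == qj a) = false. Proof. by rewrite -val_eqE ltn_eqF. Qed.
Let jx : (qj a == x) = false. Proof. by rewrite eq_sym. Qed.
Let ij' : (qi a == qj a) = false. Proof. by rewrite -val_eqE (ltn_eqF (arc_lt ar)). Qed.
Let ji : (qj a == qi a) = false. Proof. by rewrite eq_sym. Qed.
Let eqs := (ix, xi', xj', jx, ij', ji, eqxx).

Let Ii : ~~ I0 (qi a). Proof. by rewrite /I0 (negbTE (before_arcNi ar)). Qed.
Let Ij : ~~ I0 (qj a). Proof. by rewrite /I0 (negbTE (before_arcNj ar)). Qed.
Let Ix : ~~ I0 x. Proof. by rewrite /I0 eqxx andbF. Qed.

Let inA k : k \in qA a -> k != x -> I0 k.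
Proof. by move=> kA kx; rewrite /I0 kx /before_arc kA orbT. Qed.

Let outB k : k \in qB a -> k != x -> ~~ I0 k /\ k \notin L.
Proof.
move=> kB kx; have := arc_mem k ar; rewrite kB orbT => /esym/andP[ik kj]; split.
  apply/nandP; left; apply/norP; split; first by rewrite -leqNgt ltnW.
  by apply/negP=> /(arc_disj ar)/(_ kB).
by rewrite !inE (negbTE kx) !negb_or -!val_eqE /= neq_ltn ik orbT neq_ltn kj.
Qed.

Let before l k y : k \in qA a -> k != x -> ~~ I0 y -> precedes (arrange I0 l 1%g) k y.
Proof. by move=> kA kx Iy; apply: arrange_in Iy; apply: inA. Qed.

Let after l k y : {subset l <= L} -> k \in qB a -> k != x -> y \in l -> ~~ I0 y ->
  precedes (arrange I0 l 1%g) y k.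
Proof.
move=> lL kB kx yL Iy; have [Ik kL] := outB kB kx; apply: arrange_out => //.
by apply: contra kL; apply: lL.
Qed.

Let sub3 u v w : u \in L -> v \in L -> w \in L -> {subset [:: u; v; w] <= L}.
Proof. by move=> uL vL wL z; rewrite !in_cons in_nil => /or4P[/eqP->|/eqP->|/eqP->|]. Qed.

Let iL : qi a \in L. Proof. by rewrite !inE eqxx. Qed.
Let xL : x \in L. Proof. by rewrite !inE eqxx orbT. Qed.
Let jL : qj a \in L. Proof. by rewrite !inE eqxx !orbT. Qed.

Let idx l y z : ~~ I0 y -> ~~ I0 z -> (index y l < index z l)%N -> precedes (arrange I0 l 1%g) y z.
Proof. exact: arrange_index. Qed.

(** A missing arc is extended to the left by means of a hexagon. The letters [qi a], [x]
    and [qj a] are consecutive, and the exchange of [x] and [qj a] is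
    contracted. If [x] comes before the descent of [a], the exchange is taken
    at the bottom of the hexagon and joins contract the upper part of the
    opposite chain, where [qi a] and [qj a] are exchanged after [x]; otherwise
    it is taken at the top and meets contract the lower part, where they are
    exchanged before [x]. *)
Lemma force_left : ~~ arcs_of e (restr a x (qj a)) -> ~~ arcs_of e a.
Proof.
have bar : is_arc (restr a x (qj a)) by rewrite is_arc_restr // ltnW.
have oA k : k \in qA (restr a x (qj a)) -> (k \in qA a) /\ k != x.
  by rewrite !inE -val_eqE => /and3P[-> xk _]; rewrite gtn_eqF.
have oB k : k \in qB (restr a x (qj a)) -> (k \in qB a) /\ k != x.
  by rewrite !inE -val_eqE => /and3P[-> xk _]; rewrite gtn_eqF.
have := arc_mem x ar; rewrite xi xj => /orP[xA|xB] /negbTE miss.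
  have r1 := @arrange_raises n I0 [:: qi a] [::] 1%g x (qj a) _ Ix Ij xj.
  have r2 := @arrange_raises n I0 [::] [:: qj a] 1%g (qi a) x _ Ii Ix xi.
  have r3 := @arrange_raises n I0 [:: x] [::] 1%g (qi a) (qj a) _ Ii Ij (arc_lt ar).
  rewrite /= !inE !eqs /= in r1 r2 r3.
  have {}r1 := r1 isT; have {}r2 := r2 isT; have {}r3 := r3 isT.
  have H1 : e (arrange I0 [:: qi a; x; qj a] 1%g) (arrange I0 [:: qi a; qj a; x] 1%g).
    rewrite (arc_contracted econ bar r1) ?miss // => k.
      by case/oA=> kA kx; apply: before.
    by case/oB=> kB kx; apply: after; rewrite ?inE ?eqxx ?orbT //; apply: sub3.
  have [m1 m2] : (qj a, x) \in inversions (arrange I0 [:: qi a; qj a; x] 1%g) /\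
      (x, qi a) \in inversions (arrange I0 [:: x; qi a; qj a] 1%g).
    by case: r1 r2 => _ _ -> [_ _ ->]; rewrite !inE !eqxx.
  have H2 := force_join econ H1 (raises_le r1) (raises_le r2) r3
    (subsetP (subsetUl _ _) _ m1) (subsetP (subsetUr _ _) _ m2).
  rewrite -(arc_contracted econ ar r3) //.
  - move=> k kA; have [->|kx] := eqVneq k x; last exact: before.
    by apply: idx; rewrite //= !eqs.
  - move=> k kB; have kx : k != x by apply: contraTneq kB => ->; apply/negP=> /(arc_disj ar xA).
    by apply: after; rewrite ?inE ?eqxx ?orbT //; apply: sub3.
have r1 := @arrange_raises n I0 [::] [:: qi a] 1%g x (qj a) _ Ix Ij xj.
have r2 := @arrange_raises n I0 [:: qj a] [::] 1%g (qi a) x _ Ii Ix xi.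
have r3 := @arrange_raises n I0 [::] [:: x] 1%g (qi a) (qj a) _ Ii Ij (arc_lt ar).
rewrite /= !inE !eqs /= in r1 r2 r3.
have {}r1 := r1 isT; have {}r2 := r2 isT; have {}r3 := r3 isT.
have H1 : e (arrange I0 [:: x; qj a; qi a] 1%g) (arrange I0 [:: qj a; x; qi a] 1%g).
  rewrite (arc_contracted econ bar r1) ?miss // => k.
    by case/oA=> kA kx; apply: before.
  by case/oB=> kB kx; apply: after; rewrite ?inE ?eqxx ?orbT //; apply: sub3.
have [_ n1 _] := r1; have [_ n2 _] := r2.
have H2 : e (arrange I0 [:: qi a; qj a; x] 1%g) (arrange I0 [:: qj a; qi a; x] 1%g).
  apply: (force_meet econ H1 (raises_le r1) (raises_le r2) r3 (b := x)).
  - by rewrite xi.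
  - by rewrite inE (negbTE n1).
  - by rewrite inE (negbTE n2) andbF.
rewrite -(arc_contracted econ ar r3) //.
- move=> k kA; have kx : k != x by apply: contraTneq kA => ->; apply/negP=> /(arc_disj ar)/(_ xB).
  exact: before.
move=> k kB; have [->|kx] := eqVneq k x; first by apply: idx; rewrite //= !eqs.
by apply: after; rewrite ?inE ?eqxx ?orbT //; apply: sub3.
Qed.

Lemma force_right : ~~ arcs_of e (restr a (qi a) x) -> ~~ arcs_of e a.
Proof.
have bar : is_arc (restr a (qi a) x) by rewrite is_arc_restr // ltnW.
have oA k : k \in qA (restr a (qi a) x) -> (k \in qA a) /\ k != x.
  by rewrite !inE -val_eqE => /and3P[-> _ xk]; rewrite ltn_eqF.
have oB k : k \in qB (restr a (qi a) x) -> (k \in qB a) /\ k != x.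
  by rewrite !inE -val_eqE => /and3P[-> _ xk]; rewrite ltn_eqF.
have := arc_mem x ar; rewrite xi xj => /orP[xA|xB] /negbTE miss.
  have r1 := @arrange_raises n I0 [:: qj a] [::] 1%g (qi a) x _ Ii Ix xi.
  have r2 := @arrange_raises n I0 [::] [:: qi a] 1%g x (qj a) _ Ix Ij xj.
  have r3 := @arrange_raises n I0 [:: x] [::] 1%g (qi a) (qj a) _ Ii Ij (arc_lt ar).
  rewrite /= !inE !eqs /= in r1 r2 r3.
  have {}r1 := r1 isT; have {}r2 := r2 isT; have {}r3 := r3 isT.
  have H1 : e (arrange I0 [:: qj a; qi a; x] 1%g) (arrange I0 [:: qj a; x; qi a] 1%g).
    rewrite (arc_contracted econ bar r1) ?miss // => k.
      by case/oA=> kA kx; apply: before.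
    by case/oB=> kB kx; apply: after; rewrite ?inE ?eqxx ?orbT //; apply: sub3.
  have [_ n1 _] := r1; have [_ n2 _] := r2.
  have H2 : e (arrange I0 [:: x; qi a; qj a] 1%g) (arrange I0 [:: x; qj a; qi a] 1%g).
    apply: (force_meet econ H1 (raises_le r1) (raises_le r2) r3 (b := x)).
    - by rewrite xi.
    - by rewrite inE (negbTE n2) andbF.
    - by rewrite inE (negbTE n1).
  rewrite -(arc_contracted econ ar r3) //.
  - move=> k kA; have [->|kx] := eqVneq k x; last exact: before.
    by apply: idx; rewrite //= !eqs.
  move=> k kB; have kx : k != x by apply: contraTneq kB => ->; apply/negP=> /(arc_disj ar xA).
  by apply: after; rewrite ?inE ?eqxx ?orbT //; apply: sub3.
have r1 := @arrange_raises n I0 [::] [:: qj a] 1%g (qi a) x _ Ii Ix xi.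
have r2 := @arrange_raises n I0 [:: qi a] [::] 1%g x (qj a) _ Ix Ij xj.
have r3 := @arrange_raises n I0 [::] [:: x] 1%g (qi a) (qj a) _ Ii Ij (arc_lt ar).
rewrite /= !inE !eqs /= in r1 r2 r3.
have {}r1 := r1 isT; have {}r2 := r2 isT; have {}r3 := r3 isT.
have H1 : e (arrange I0 [:: qi a; x; qj a] 1%g) (arrange I0 [:: x; qi a; qj a] 1%g).
  rewrite (arc_contracted econ bar r1) ?miss // => k.
    by case/oA=> kA kx; apply: before.
  by case/oB=> kB kx; apply: after; rewrite ?inE ?eqxx ?orbT //; apply: sub3.
have [m1 m2] : (x, qi a) \in inversions (arrange I0 [:: x; qi a; qj a] 1%g) /\
    (qj a, x) \in inversions (arrange I0 [:: qi a; qj a; x] 1%g).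
  by case: r1 r2 => _ _ -> [_ _ ->]; rewrite !inE !eqxx.
have H2 := force_join econ H1 (raises_le r1) (raises_le r2) r3
  (subsetP (subsetUr _ _) _ m2) (subsetP (subsetUl _ _) _ m1).
rewrite -(arc_contracted econ ar r3) //.
- move=> k kA; have kx : k != x by apply: contraTneq kA => ->; apply/negP=> /(arc_disj ar)/(_ xB).
  exact: before.
move=> k kB; have [->|kx] := eqVneq k x; first by apply: idx; rewrite //= !eqs.
by apply: after; rewrite ?inE ?eqxx ?orbT //; apply: sub3.
Qed.

End Step.

(** The missing subarc is extended to the right, then to the left. *)
Lemma missing_restr a i k : is_arc a -> (qi a <= i)%N -> (i < k)%N ->
  (k <= qj a)%N -> ~~ arcs_of e (restr a i k) -> ~~ arcs_of e a.
Proof.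
move=> ar ai ik kj miss; have ij := leq_trans ik kj.
have ai' : is_arc (restr a i (qj a)) by apply: is_arc_restr.
have missi : ~~ arcs_of e (restr a i (qj a)).
  move: kj; rewrite leq_eqVlt => /orP[/eqP/val_inj kE|kj]; first by rewrite -kE.
  by apply: (force_right ai' (x := k)) => //=; rewrite restr_restr // ltnW.
move: ai; rewrite leq_eqVlt => /orP[/eqP/val_inj iE|ai].
  by rewrite -(restr_id ar) iE.
exact: (force_left ar ai ij).
Qed.

Hypothesis esimple : simple e.

(** A shortest missing subarc is minimal among the missing arcs, as a subarc
    with the same ends is the whole arc; simplicity makes it an up or a down
    arc. *)
Lemma missing_wall a : is_arc a -> ~~ arcs_of e a ->
  exists i k : 'I_n, [/\ (qi a <= i)%N, (i < k)%N, (k <= qj a)%N &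
    missing_arc e (up_arc i k) && (oint i k \subset qA a) ||
    missing_arc e (down_arc i k) && (oint i k \subset qB a)].
Proof.
move=> ar miss.
pose C := [pred p : 'I_n * 'I_n | [&& (qi a <= p.1)%N, (p.1 < p.2)%N, (p.2 <= qj a)%N &
  ~~ arcs_of e (restr a p.1 p.2)]].
have C0 : C (qi a, qj a) by rewrite /= leqnn (arc_lt ar) leqnn restr_id.
case: (arg_minnP (fun p : 'I_n * 'I_n => p.2 - p.1)%N C0) => -[i k] /= /and4P[ai ik kj ms] mn.
have ark := is_arc_restr ar ai ik kj.
have [|b /andP[bar bms] sb||] := esimple (a := restr a i k).
- by rewrite /missing_arc ark.
- case/and4P: (sb) => /= /andP[ib bij] jk AA BB.
  have bE : b = restr a (qi b) (qj b).
    by apply: arc_restr_sub => //;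
      [apply: subset_trans AA _|apply: subset_trans BB _]; apply: subsetIl.
  have := mn (qi b, qj b); rewrite /= bij (leq_trans ai ib) (leq_trans jk kj) -bE bms.
  move=> /(_ isT) /= le; have [iE kE] : i = qi b /\ k = qj b.
    by split; apply: val_inj => /=; move: ib bij jk le ik; clear; lia.
  by rewrite bE -iE -kE.
- case=> i' [k' [iE kE AE BE]]; exists i, k; split=> //; apply/orP; left.
  rewrite iE kE /missing_arc -[up_arc _ _]/(Quad _ _ _ _) -AE -BE -iE -kE.
  by rewrite -/(restr a i k) ark ms /= subsetIl.
case=> i' [k' [iE kE AE BE]]; exists i, k; split=> //; apply/orP; right.
rewrite iE kE /missing_arc -[down_arc _ _]/(Quad _ _ _ _) -AE -BE -iE -kE.
by rewrite -/(restr a i k) ark ms /= subsetIl.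
Qed.

End Forcing.

(** * The poset of a congruence class *)

Lemma hull_between (T : finType) (h : T -> nat) x y i k z :
  hull h x y i k -> between h i z k -> z != x /\ z != y.
Proof.
move=> hl bz; split; apply: contraTneq bz => zE; move: hl;
  rewrite /hull /between zE; clear; lia.
Qed.

Section ClassPoset.
Variables (n : nat) (e : rel 'S_n) (s0 : 'S_n).
Hypothesis econ : lattice_congruence e.
Implicit Types (s t m : 'S_n) (x y u v i k : 'I_n) (I : pred 'I_n).

Definition class_poset : rel 'I_n := [rel x y | [forall t, e s0 t ==> precedes t x y]].
Local Notation P := class_poset.

Lemma class_posetP x y : reflect (forall t, e s0 t -> precedes t x y) (P x y).
Proof. by apply: (iffP forallP) => H t; apply/implyP; apply: H. Qed.

Lemma class_poset_irr : irreflexive P.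
Proof.
by move=> x; apply/negP=> /class_posetP/(_ s0 (cong_refl econ _)); rewrite precedes_irr.
Qed.

Lemma class_poset_tr : transitive P.
Proof.
move=> y x z /class_posetP xy /class_posetP yz; apply/class_posetP => t et.
exact: precedes_trans (xy t et) (yz t et).
Qed.

Lemma class_poset_asym x y : P x y -> ~~ P y x.
Proof.
move=> xy; apply/negP=> yx.
by have := class_poset_tr xy yx; rewrite class_poset_irr.
Qed.

(** The linear extension [t] has all the inversions of the minimum of the
    class, which are inversions of all its members, and only inversions of its
    maximum; classes are convex. *)
Lemma linear_extension t : (forall x y, P x y -> precedes t x y) -> e s0 t.
Proof.
move=> Pt; have [m em mmin] := class_has_min econ s0.
have [M eM Mmax] := class_has_max econ s0.
have [em' eM'] : e m s0 /\ e M s0 by rewrite ![e _ s0](cong_sym econ).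
have mt : weak_le m t.
  apply/weak_leP => c a ca; have ac : (a < c)%N by move: ca; rewrite mem_inv => /andP[].
  rewrite mem_inv ac; apply: Pt; apply/class_posetP => t' et'.
  have /weak_leP/(_ c a ca) : weak_le m t'.
    by apply: (implyP (forallP mmin t')); apply: (cong_trans econ) em' et'.
  by rewrite mem_inv ac.
have tM : weak_le t M.
  apply/weak_leP => c a; rewrite !mem_inv => /andP[ac ca]; rewrite ac /=.
  have ne : a != c by apply: contraTneq ac => ->; rewrite ltnn.
  rewrite -(precedesN _ ne); apply: contraL ca => aMc; apply: precedes_asym; apply: Pt.
  apply/class_posetP => t' et'; rewrite -precedesN 1?eq_sym //; apply/negP=> ca.
  have /weak_leP/(_ c a) := Mmax t' (cong_trans econ eM' et').
  by rewrite !mem_inv ac ca => /(_ isT) /= /precedes_asym; rewrite aMc.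
apply: (cong_trans econ em); apply: (cong_convex econ mt tM).
exact: (cong_trans econ em' eM).
Qed.

(** The sets [I] that a linear extension can place before [x] and [y] when
    these two are consecutive. *)
Definition cut x y I : Prop :=
  [/\ forall u v, P u v -> I v -> I u, ~~ I x, ~~ I y,
      forall u, P u x -> u = y \/ I u & forall u, P u y -> u = x \/ I u].

Lemma cutC x y I : cut x y I -> cut y x I.
Proof. by case. Qed.

Lemma cut_extension x y I : x != y -> cut x y I -> ~~ P y x ->
  e s0 (arrange I [:: x; y] s0).
Proof.
move=> ne [Idown nIx nIy Ix Iy] nyx; apply: linear_extension => u v uv.
have uv0 : precedes s0 u v by move/class_posetP: uv; apply; apply: cong_refl.
rewrite precedes_arrange /block uv0 andbT.
have [Iv|nIv] := boolP (I v); first by rewrite (Idown u v uv Iv) eqxx orbT.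
have [Iu|nIu] := boolP (I u); first by [].
rewrite /= !ltnS ![_ == u]eq_sym ![_ == v]eq_sym.
have [ux|ux] := eqVneq u x; first by case: (v == x) => //; case: (v == y).
have [uy|uy] := eqVneq u y.
  case: eqVneq => [vx|vx]; first by rewrite -uy -vx uv in nyx.
  by case: (v == y).
case: eqVneq => [vx|_]; first rewrite vx in uv.
  by case: (Ix u uv) => [uE|Iu]; rewrite ?uE ?eqxx ?Iu in uy nIu.
case: eqVneq => [vy|_] //; rewrite vy in uv.
by case: (Iy u uv) => [uE|Iu]; rewrite ?uE ?eqxx ?Iu in ux nIu.
Qed.

Definition cut_arc x y I : quad n :=
  Quad x y [set z in oint x y | I z] [set z in oint x y | ~~ I z].

Lemma is_cut_arc x y I : (x < y)%N -> is_arc (cut_arc x y I).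
Proof.
move=> xy; apply/and3P; split=> //=.
  by apply/eqP/setP => z; rewrite !inE -andb_orr orbN andbT.
by apply/pred0P => z /=; rewrite !inE; case: (I z); rewrite ?andbF.
Qed.

(** Exchanging [x] and [y] after [I] stays in the class exactly when both
    orders are linear extensions. *)
Lemma cut_arc_missing x y I : (x < y)%N -> cut x y I ->
  (~~ P x y && ~~ P y x) = ~~ arcs_of e (cut_arc x y I).
Proof.
move=> xy c; have xNy : x != y by apply: contraTneq xy => ->; rewrite ltnn.
have yNx : y != x by rewrite eq_sym.
have [_ nIx nIy _ _] := c.
have r := @arrange_raises n I [::] [::] s0 x y _ nIx nIy xy.
rewrite /= inE xNy /= in r; have {}r := r isT.
rewrite -(arc_contracted econ (is_cut_arc I xy) r).
- have [bxy byx] := raises_precedes r.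
  apply/andP/idP => [[nxy nyx]|ess].
    have e1 := cut_extension xNy c nyx.
    have e2 := cut_extension yNx (cutC c) nxy.
    by apply: (cong_trans econ) e2; rewrite (cong_sym econ).
  have ess' := ess; rewrite (cong_sym econ) in ess'.
  split; apply/negP=> Pxy; have /class_posetP Pt := Pxy.
    have e1 := cut_extension xNy c (class_poset_asym Pxy).
    by have /precedes_asym := Pt _ (cong_trans econ e1 ess); rewrite byx.
  have e2 := cut_extension yNx (cutC c) (class_poset_asym Pxy).
  by have /precedes_asym := Pt _ (cong_trans econ e2 ess'); rewrite bxy.
- by move=> z; rewrite !inE => /andP[_ Iz]; apply: arrange_in.
move=> z; rewrite !inE => /andP[/andP[xz zy] Iz]; apply: arrange_out => //.
  by rewrite !inE eqxx orbT.
by rewrite !inE negb_or -!val_eqE /= neq_ltn xz orbT neq_ltn zy.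
Qed.

Hypothesis esimple : simple e.

Definition up i k : bool := missing_arc e (up_arc i k).
Definition down i k : bool := missing_arc e (down_arc i k).
Local Notation ht := (@nat_of_ord n).

Lemma cut_wall x y I : x != y -> cut x y I -> ~~ P x y -> ~~ P y x ->
  exists i k, hull ht x y i k /\
    ((up i k /\ forall z, between ht i z k -> I z) \/
     (down i k /\ forall z, between ht i z k -> ~~ I z)).
Proof.
wlog xy : x y / (x < y)%N.
  move=> H ne c nxy nyx; case: (ltngtP x y) => [xy|yx|/val_inj xy].
  - exact: H.
  - have [|i [k [hl D]]] := H y x yx _ (cutC c) nyx nxy; first by rewrite eq_sym.
    by exists i, k; rewrite hullC.
  - by rewrite xy eqxx in ne.
move=> ne c nxy nyx; have := cut_arc_missing xy c; rewrite nxy nyx => /esym ms.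
have [i [k [xi ik ky D]]] := missing_wall esimple (is_cut_arc I xy) ms.
exists i, k; split; first exact: hull_le.
have sub (J : pred 'I_n) : oint i k \subset [set z in oint x y | J z] ->
    forall z, between ht i z k -> J z.
  move=> /subsetP S z bz; have := S z; rewrite !inE -/(between ht i z k) bz.
  by move=> /(_ isT)/andP[].
by case/orP: D => /andP[m /sub S]; [left|right].
Qed.

Lemma cut_nowall x y I i k : P x y -> cut x y I -> hull ht x y i k ->
  (up i k -> exists2 z, between ht i z k & ~~ I z) /\
  (down i k -> exists2 z, between ht i z k & I z).
Proof.
have main u v : (u < v)%N -> cut u v I -> P u v || P v u -> hull ht u v i k ->
  (up i k -> exists2 z, between ht i z k & ~~ I z) /\
  (down i k -> exists2 z, between ht i z k & I z).
  move=> uv c Puv /(hull_lt uv)[ui ik kv].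
  have ar := is_cut_arc I uv.
  have := cut_arc_missing uv c; rewrite -negb_or Puv /= => /esym/negbT pr.
  have in_oint z : between ht i z k -> z \in oint u v.
    by rewrite inE => /andP[iz zk]; rewrite (leq_ltn_trans ui iz) (leq_trans zk kv).
  have ck b : missing_arc e b -> restr (cut_arc u v I) i k <> b.
    move=> /andP[_ mb] E; move/negP: pr; apply.
    by apply: (missing_restr econ ar ui ik kv); rewrite E.
  have ex (J : pred 'I_n) : ~ (forall z, between ht i z k -> ~~ J z) ->
      exists2 z, between ht i z k & J z.
    move=> H; case: (pickP [pred z | between ht i z k && J z]) => [z /andP[]|none].
      by exists z.
    by case: H => z bz; have /= := none z; rewrite bz => /= ->.
  split=> m; apply: ex => H; apply: (ck _ m); rewrite /restr /=; congr Quad.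
  - apply/setP => z; rewrite !inE -/(between ht i z k);
    case: (boolP (between ht i z k)) => bz; rewrite ?andbF ?andbT //.
    by have := in_oint z bz; rewrite inE => ->; have := H z bz; rewrite negbK.
  - apply/setP => z; rewrite !inE -/(between ht i z k);
    case: (boolP (between ht i z k)) => bz; rewrite ?andbF ?andbT //.
    by apply/negbTE/nandP; right; apply: H.
  - apply/setP => z; rewrite !inE -/(between ht i z k);
    case: (boolP (between ht i z k)) => bz; rewrite ?andbF ?andbT //.
    by apply/negbTE/nandP; right; apply: H.
  - apply/setP => z; rewrite !inE -/(between ht i z k);
    case: (boolP (between ht i z k)) => bz; rewrite ?andbF ?andbT //.
    by have := in_oint z bz; rewrite inE => ->; have := H z bz.
move=> xy c; case: (ltngtP x y) => [lt|lt|/val_inj E].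
- by apply: main; rewrite ?xy.
- by rewrite hullC; apply: main; rewrite ?xy ?orbT //; apply: cutC.
- by rewrite E class_poset_irr in xy.
Qed.

Definition low_cut x y : pred 'I_n := [pred z | [&& z != x, z != y & P z x || P z y]].
Definition high_cut x y : pred 'I_n :=
  [pred z | [&& z != x, z != y, ~~ P x z & ~~ P y z]].

Lemma low_cutP x y : (forall z, P x z -> P z y -> False) ->
  (forall z, P y z -> P z x -> False) -> cut x y (low_cut x y).
Proof.
move=> nb nb'; split; rewrite /low_cut /= ?eqxx ?andbF //.
- move=> u v uv /and3P[vx vy Pv]; apply/and3P; split.
  + apply/eqP => uE; rewrite uE in uv; case/orP: Pv => Pv; last exact: nb uv Pv.
    by have := class_poset_asym uv; rewrite Pv.
  + apply/eqP => uE; rewrite uE in uv; case/orP: Pv => Pv; first exact: nb' uv Pv.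
    by have := class_poset_asym uv; rewrite Pv.
  by case/orP: Pv => Pv; rewrite (class_poset_tr uv Pv) ?orbT.
- move=> u ux; case: (eqVneq u y) => [->|uy]; [by left|right]; rewrite ux /= andbT.
  by apply: contraTneq ux => ->; rewrite class_poset_irr.
- move=> u uy; case: (eqVneq u x) => [->|ux]; [by left|right]; rewrite uy orbT andbT.
  by apply: contraTneq uy => ->; rewrite class_poset_irr.
Qed.

Lemma high_cutP x y : (forall z, P x z -> P z y -> False) ->
  (forall z, P y z -> P z x -> False) -> cut x y (high_cut x y).
Proof.
move=> nb nb'; split; rewrite /high_cut /= ?eqxx ?andbF //.
- move=> u v uv /and4P[vx vy nxv nyv]; apply/and4P; split.
  + by apply: contraNneq nxv => <-.
  + by apply: contraNneq nyv => <-.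
  + by apply: contra nxv => xu; apply: class_poset_tr xu uv.
  + by apply: contra nyv => xu; apply: class_poset_tr xu uv.
- move=> u ux; case: (eqVneq u y) => [->|uy]; [by left|right].
  rewrite (class_poset_asym ux) /=; apply/andP; split.
    by apply: contraTneq ux => ->; rewrite class_poset_irr.
  by apply/negP=> yu; apply: nb' yu ux.
- move=> u uy; case: (eqVneq u x) => [->|ux]; [by left|right].
  rewrite (class_poset_asym uy) /= andbT; apply/andP; split.
    by apply: contraTneq uy => ->; rewrite class_poset_irr.
  by apply/negP=> xu; apply: nb xu uy.
Qed.

Lemma class_poset_walled : walled P ht up down.
Proof.
have incomp x y : ~~ P x y -> ~~ P y x ->
    (forall z, P x z -> P z y -> False) /\ (forall z, P y z -> P z x -> False).
  by move=> nxy nyx; split=> z a b; have := class_poset_tr a b; apply/negP.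
have cov x y : covers P x y ->
    (forall z, P x z -> P z y -> False) /\ (forall z, P y z -> P z x -> False).
  move=> c; have xy := coversW c; split=> z a b; first exact: covers_between c a b.
  by have := class_poset_asym xy; rewrite (class_poset_tr a b).
split.
- exact: class_poset_irr.
- exact: class_poset_tr.
- exact: val_inj.
- move=> x y i k c hl u; have [nb nb'] := cov _ _ c.
  have [/(_ u)[z bz] nz _] := cut_nowall (coversW c) (high_cutP nb nb') hl.
  have [zx zy] := hull_between hl bz; exists z => //.
  move: nz; rewrite /high_cut /= zx zy /= negb_and !negbK => /orP[//|].
  exact: class_poset_tr (coversW c).
- move=> x y i k c hl u; have [nb nb'] := cov _ _ c.
  have [_ /(_ u)[z bz]] := cut_nowall (coversW c) (low_cutP nb nb') hl.
  case/and3P=> _ _ /orP[zx|zy]; exists z => //.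
  exact: class_poset_tr zx (coversW c).
- move=> x y ne nxy nyx; have [nb nb'] := incomp _ _ nxy nyx.
  have [i [k [hl D]]] := cut_wall ne (low_cutP nb nb') nxy nyx.
  exists i, k; split=> //; case: D => -[u H]; [left|right]; split=> // z bz.
    by case/and3P: (H z bz).
  have [zx zy] := hull_between hl bz.
  by have := H z bz; rewrite /low_cut /= zx zy /= negb_or.
- move=> x y ne nxy nyx; have [nb nb'] := incomp _ _ nxy nyx.
  have [i [k [hl D]]] := cut_wall ne (high_cutP nb nb') nxy nyx.
  exists i, k; split=> //; case: D => -[u H]; [right|left]; split=> // z bz.
    by case/and4P: (H z bz) => _ _ -> ->.
  have [zx zy] := hull_between hl bz.
  by have := H z bz; rewrite /high_cut /= zx zy /= negb_and !negbK.
Qed.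

End ClassPoset.

(** * Connectedness, cones and faces *)

Section Connected.
Variables (n : nat) (e : rel 'S_n) (s0 : 'S_n).
Hypotheses (econ : lattice_congruence e) (esimple : simple e) (eess : essential e).
Local Notation P := (class_poset e s0).

(** There is no room for a wall between consecutive values, except for the arc
    joining them, which an essential congruence keeps. *)
Lemma consecutive_comparable (x y : 'I_n) : y = x.+1 :> nat -> P x y || P y x.
Proof.
move=> yx; apply/norP => -[nxy nyx].
have ne : x != y by rewrite -val_eqE /= yx neq_ltn ltnSn.
have o0 : oint x y = set0.
  by apply/setP => z; rewrite !inE yx ltnS; clear; lia.
have ess := eess yx.
have [i [k [hl D]]] := incomparable_low (class_poset_walled s0 econ esimple) ne nxy nyx.
have [iE kE] : i = x /\ k = y.
  have [|xi ik ky] := hull_lt _ hl; first by rewrite yx.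
  by split; apply: val_inj => /=; move: xi ik ky yx; clear; lia.
by case: D => -[+ _]; rewrite /up /down /missing_arc /up_arc /down_arc iE kE o0 ess andbF.
Qed.

Lemma hasse_connected (x y : 'I_n) : connect (hasse_adj P) x y.
Proof.
have sc := sym_connect_sym (@hasse_adjC _ P).
have cmp u v : P u v -> connect (hasse_adj P) u v.
  move=> /(connect_covers (class_poset_irr s0 econ) (@class_poset_tr _ _ _)).
  by apply: connect_sub => a b ab; apply: connect1; apply/orP; left.
wlog xy : x y / (x <= y)%N.
  by move=> H; case/orP: (leq_total x y) => xy; [|rewrite sc]; apply: H.
have [m] := ubnP (y - x); elim: m x xy => // m IHm x xy ltm.
move: xy; rewrite leq_eqVlt => /orP[/eqP/val_inj->|xy]; first exact: connect0.
have x1 : (x.+1 < n)%N by apply: leq_ltn_trans xy (ltn_ord y).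
apply: (@connect_trans _ _ (Ordinal x1)).
  case/orP: (@consecutive_comparable x (Ordinal x1) erefl) => /cmp //.
  by rewrite sc.
by apply: IHm => //=; rewrite subnS; move: ltm xy; clear; lia.
Qed.

End Connected.

(** The cover relations of [P], together with the reverses of those that [r]
    contracts. *)
Definition contraction_step (T : finType) (P r : rel T) : rel T :=
  [rel x y | covers P x y || covers P y x && r x y].

Section Cone.
Variables (R : realType) (n : nat) (e : rel 'S_n) (s0 : 'S_n).
Hypotheses (econ : lattice_congruence e).
Local Notation P := (class_poset e s0).
Local Open Scope ring_scope.

(** Sorting a point of the cone by its coordinates, and equal coordinates by
    [s0], gives a linear extension. *)
Lemma class_coneP (v : 'rV[R]_n) :
  class_cone e s0 v <-> forall i j, P i j -> v 0 i <= v 0 j.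
Proof.
split=> [[t et tv] i j /class_posetP/(_ t et) ij|Pv].
  have := tv ((t^-1)%g i) ((t^-1)%g j) (ltnW ij).
  by rewrite !permKV.
have [|||t tE] := @perm_of_order n
  [rel i j | (v 0 i < v 0 j) || (v 0 i == v 0 j) && precedes s0 i j].
- by move=> i; rewrite /= ltxx precedes_irr andbF.
- move=> j i k /= /orP[ij|/andP[/eqP-> ij]] /orP[jk|/andP[/eqP jkE jk]].
  + by rewrite (lt_trans ij jk).
  + by rewrite -jkE ij.
  + by rewrite jk.
  + by rewrite jkE eqxx (precedes_trans ij jk) orbT.
- move=> i j ij /=; case: (ltgtP (v 0 i) (v 0 j)) => //= _.
  by rewrite -precedesN ?orNb // eq_sym.
exists t.
  apply: (linear_extension econ) => i j ij; rewrite tE /=.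
  have := Pv i j ij; rewrite le_eqVlt => /orP[/eqP->|->//].
  by rewrite eqxx (class_posetP _ _ _ _ ij) ?orbT //; apply: cong_refl.
move=> p q; rewrite leq_eqVlt => /orP[/eqP/val_inj->//|pq].
have : precedes t (t p) (t q) by rewrite /precedes /= !permK.
by rewrite tE /= => /orP[/ltW//|/andP[/eqP-> _]].
Qed.

Variable r : rel 'I_n.
Hypothesis rpre : preposet r.

Lemma preposet_indicator x : preposet_cone r (\row_i (r x i)%:R : 'rV[R]_n).
Proof.
move=> i j ij; rewrite !mxE ler_nat; case: (boolP (r x i)) => // xi.
by rewrite (rpre.2 _ _ _ xi ij).
Qed.

Hypothesis rface : face_of (@preposet_cone R n r) (class_cone e s0).

Lemma class_poset_sub x y : P x y -> r x y.
Proof.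
move=> xy; have [c [_ cP]] := rface.
have [/class_coneP/(_ _ _ xy) + _] := (cP _).1 (preposet_indicator x).
by rewrite !mxE rpre.1 ler_nat; case: (r x y).
Qed.

(** Let [v] be the indicator of the up-set generated by [x] for the right-hand
    side, and let [w] count the elements below each element for [r]. The vector
    [w] lies in the face and is strictly increasing along the covers that are
    not contracted, so [w - v] is in the cone. The form defining the face is
    nonnegative at [v] and at [w - v] and vanishes at [w], hence at [v]: the
    indicator [v] is in the face, and [r x y] forces [y] into the up-set. *)
Lemma face_contraction x y : r x y = connect (contraction_step P r) x y.
Proof.
apply/idP/idP => [rxy|]; last first.
  case/connectP=> p; elim: p x => [|z p IHp] x /=; first by move=> _ ->; apply: rpre.1.
  case/andP=> /orP xz pz yE; apply: (rpre.2 z) (IHp z pz yE).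
  by case: xz => [/coversW/class_poset_sub//|/andP[]].
have [c [c_ge0 cP]] := rface.
pose v : 'rV[R]_n := \row_i (connect (contraction_step P r) x i)%:R.
(* Along a cover that is not contracted, [w] increases by at least 1, which is
   the largest possible increase of [v]. *)
pose w : 'rV[R]_n := \row_i #|[pred u | r u i]|%:R.
have w_face : preposet_cone r w.
  move=> i j ij; rewrite !mxE ler_nat; apply: subset_leq_card; apply/subsetP => u.
  by rewrite !inE => ui; apply: rpre.2 ij.
have [w_cone w0] := (cP w).1 w_face.
have Pirr := class_poset_irr s0 econ; have Ptr := @class_poset_tr n e s0.
have covers_cone (u : 'rV[R]_n) : (forall i j, covers P i j -> u 0 i <= u 0 j) -> class_cone e s0 u.
  move=> uc; apply/class_coneP => i j /(connect_covers Pirr Ptr)/connectP[p].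
  elim: p i => [|k p IHp] i /=; first by move=> _ ->.
  by case/andP=> ik pk jE; apply: le_trans (uc _ _ ik) (IHp k pk jE).
have step i j : contraction_step P r i j ->
    connect (contraction_step P r) x i -> connect (contraction_step P r) x j.
  by move=> ij xi; apply: connect_trans xi (connect1 ij).
have v_cone : class_cone e s0 v.
  apply: covers_cone => i j ij; rewrite !mxE ler_nat.
  case: (boolP (connect _ x i)) => // xi.
  by rewrite (step i j _ xi) //; apply/orP; left.
have wv_cone : class_cone e s0 (w - v).
  apply: covers_cone => i j ij; rewrite !mxE.
  case: (boolP (r j i)) => ji.
    have -> : #|[pred u | r u j]| = #|[pred u | r u i]|.
      apply: eq_card => u; rewrite !inE; apply/idP/idP => H; first exact: rpre.2 H ji.
      exact: rpre.2 H (class_poset_sub (coversW ij)).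
    suff -> : connect (contraction_step P r) x i = connect (contraction_step P r) x j by [].
    by apply/idP/idP; apply: step; apply/orP; [left|right; rewrite ji andbT].
  have lt : (#|[pred u | r u i]| < #|[pred u | r u j]|)%N.
    apply: proper_card; apply/properP; split.
      apply/subsetP => u; rewrite !inE => ui; apply: rpre.2 ui _.
      exact: class_poset_sub (coversW ij).
    by exists j; rewrite !inE ?rpre.1.
  rewrite lerBlDr addrAC lerBrDr -!natrD ler_nat; move: lt; clear.
  by case: (connect _ x i); case: (connect _ x j); lia.
have cv0 : \sum_i c 0 i * v 0 i = 0.
  apply/eqP; rewrite eq_le c_ge0 // andbT -oppr_ge0.
  have wvE : \sum_i c 0 i * (w - v) 0 i = \sum_i c 0 i * w 0 i - \sum_i c 0 i * v 0 i.
    by rewrite -sumrB; apply: eq_bigr => i _; rewrite !mxE mulrBr.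
  by have := c_ge0 _ wv_cone; rewrite wvE w0 add0r.
have := (cP v).2 (conj v_cone cv0) x y rxy.
by rewrite !mxE connect0 ler_nat; case: (connect _ x y).
Qed.

End Cone.

(** * Contracting a separating tree *)

Section Valley.
Variables (T : finType) (h : T -> nat) (adj cov : rel T).
Hypotheses (adjC : symmetric adj) (adjE : forall u v, adj u v = cov u v || cov v u).
Hypothesis ac : acyclic adj.

Lemma separates_sub c (A A' B B' : pred T) : {subset A' <= A} -> {subset B' <= B} ->
  separates h c A B -> separates h c A' B'.
Proof.
move=> AA BB [[Ac Bc]|[Bc Ac]]; [left|right]; split=> z zin.
- by apply: Ac; apply: AA.
- by apply: Bc; apply: BB.
- by apply: Bc; apply: BB.
- by apply: Ac; apply: AA.
Qed.

Hypothesis sep : forall j a b, cov j a -> cov j b -> a != b ->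
  separates h j (branch adj j a) (branch adj j b).

Lemma branch_path_nest a c l q : path adj a (c :: l) -> uniq (a :: c :: l) ->
  adj (last c l) q -> q \notin a :: c :: l ->
  {subset branch adj (last c l) q <= branch adj a c}.
Proof.
elim: l a c => [|c' l IHl] a c /=.
  rewrite andbT inE => ac' /andP[nac _] cq; rewrite !inE !negb_or => /andP[qa _] z.
  by apply: (branch_nest ac); rewrite // 1?adjC // eq_sym.
case/and3P=> aac cc' pl /and3P[anin cnin ul] lq qnin z zq.
have {}IH := IHl c c'; rewrite /= cc' pl in IH.
have qn2 : q \notin [:: c, c' & l] by apply: contra qnin => H; rewrite inE H orbT.
have /= := IH isT _ lq qn2 z zq; rewrite cnin ul => /(_ isT) zc.
move: anin; rewrite !inE !negb_or => /and3P[nac nac' _].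
by apply: (branch_nest ac _ _ _ _ zc); rewrite // 1?adjC // eq_sym.
Qed.

(** Follow the path from [a]. If it leaves [a] upwards, [a] separates the branch
    of [p] from the rest of the path, which carries the branch of [q].
    Otherwise its next element [c] has [a] above it, and the branch of [p] at
    [a] is contained in the branch of [a] at [c], so that [a] can play the role
    of [p] for the shorter path. The other orientation of the edges is obtained
    by the choice of [cov]. *)
Lemma valley_separates l a p q : path adj a l -> uniq (a :: l) ->
  cov a p -> cov (last a l) q -> p \notin a :: l -> q \notin a :: l -> p != q ->
  exists2 c, c \in a :: l & separates h c (branch adj a p) (branch adj (last a l) q).
Proof.
elim: l a p => [|c l IHl] a p /=.
  by move=> _ _ ap aq _ _ pq; exists a; rewrite ?mem_head //; apply: sep.
case/andP=> adac pl /andP[anin ul] ap lq pnin qnin pq.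
have adlq : adj (last c l) q by rewrite adjE lq.
move: (adac); rewrite adjE => /orP[ac'|ca].
  exists a; first exact: mem_head.
  have pc : p != c by apply: contraNneq pnin => ->; rewrite !inE eqxx orbT.
  apply: separates_sub (sep ap ac' pc) => //.
  by apply: branch_path_nest => //=; rewrite ?adac ?anin.
have aq : a != q by apply: contraNneq qnin => ->; rewrite mem_head.
have [|c' c'in sc] := IHl c a pl ul ca lq anin _ aq.
  by apply: contra qnin => H; rewrite inE H orbT.
exists c'; first by rewrite inE c'in orbT.
apply: separates_sub sc => // z zp; apply: (branch_nest ac _ _ _ _ zp).
- by rewrite adjE ap.
- exact: adac.
- by apply: contraNneq pnin => ->; rewrite !inE eqxx orbT.
- by apply: contraNneq anin => ->; rewrite mem_head.
Qed.

End Valley.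

Section Contraction.
Variables (n : nat) (P r : rel 'I_n).
Hypothesis Pirr : irreflexive P.
Local Notation adj := (hasse_adj P).
Hypotheses (ac : acyclic adj) (conn : forall x y, connect adj x y).
Hypothesis rE : forall x y, r x y = connect (contraction_step P r) x y.
Implicit Types (x y z : 'I_n) (I J K : {set 'I_n}).

Let adjC : symmetric adj := @hasse_adjC _ P.

Lemma contr_refl : reflexive r.
Proof. by move=> x; rewrite rE connect0. Qed.

Lemma contr_trans : transitive r.
Proof. by move=> y x z; rewrite !rE; apply: connect_trans. Qed.

Lemma contr_covers x y : covers P x y -> r x y.
Proof. by move=> xy; rewrite rE; apply: connect1; apply/orP; left. Qed.

Local Notation same := (preposet_equiv r).
Local Notation classes := (preposet_classes r).

Lemma sameE x y : same x y = r x y && r y x.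
Proof. by []. Qed.

Lemma same_equiv : {in [set: 'I_n] & &, equivalence_rel same}.
Proof.
move=> x y z _ _ _; split; first by rewrite sameE contr_refl.
move=> /= /andP[xy yx]; apply/andP/andP => -[a b].
  by rewrite (contr_trans yx a) (contr_trans b xy).
by rewrite (contr_trans xy a) (contr_trans b yx).
Qed.

Definition class_of x : {set 'I_n} := [set y | same x y].

Lemma class_of_in x : class_of x \in classes.
Proof.
apply/imsetP; exists x; rewrite ?inE //.
by apply/setP => y; rewrite !inE.
Qed.

Lemma mem_class_of x : x \in class_of x.
Proof. by rewrite inE sameE contr_refl. Qed.

Lemma class_eq J x : J \in classes -> x \in J -> J = class_of x.
Proof.
case/imsetP=> y _ ->; rewrite !inE /= => /andP[yx xy].
apply/setP => z; rewrite !inE /= !sameE; apply/andP/andP => -[a b].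
  by rewrite (contr_trans xy a) (contr_trans b yx).
by rewrite (contr_trans yx a) (contr_trans b xy).
Qed.

Lemma class_same J x y : J \in classes -> x \in J -> (y \in J) = same x y.
Proof. by move=> JC xJ; rewrite (class_eq JC xJ) inE. Qed.

Lemma preposet_classes_partition : partition classes [set: 'I_n].
Proof. exact/equivalence_partitionP/same_equiv. Qed.

Lemma class_nonempty J : J \in classes -> exists x, x \in J.
Proof. by case/imsetP=> x _ ->; exists x; rewrite !inE sameE contr_refl. Qed.

Lemma class_ltP I J x y : I \in classes -> J \in classes -> x \in I -> y \in J ->
  class_lt r I J = r x y && ~~ r y x.
Proof.
move=> IC JC xI yJ; rewrite /class_lt /= IC JC /=.
have -> : [exists i in I, exists j in J, r i j] = r x y.
  apply/exists_inP/idP => [[i iI /exists_inP[j jJ ij]]|xy].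
    have /andP[xi _] : same x i by rewrite -(class_same _ IC xI).
    have /andP[_ jy] : same y j by rewrite -(class_same _ JC yJ).
    exact: contr_trans (contr_trans xi ij) jy.
  by exists x => //; apply/exists_inP; exists y.
case: (boolP (r x y)) => xy; rewrite ?andbF // andbT; congr (~~ _).
apply/eqP/idP => [IJ|yx]; first by have := class_same y IC xI; rewrite IJ yJ sameE xy.
by rewrite (class_eq IC xI) -(class_eq JC _) // (class_same _ JC yJ) sameE xy yx.
Qed.

Lemma class_lt_irr : irreflexive (class_lt r).
Proof. by move=> I; rewrite /class_lt /= eqxx !andbF. Qed.

Lemma class_lt_classes I J : class_lt r I J -> I \in classes /\ J \in classes.
Proof. by case/and3P. Qed.

Lemma class_lt_tr : transitive (class_lt r).
Proof.
move=> J I K IJ JK; have [IC JC] := class_lt_classes IJ; have [_ KC] := class_lt_classes JK.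
have [[x xI] [y yJ]] := (class_nonempty IC, class_nonempty JC).
have [z zK] := class_nonempty KC.
move: IJ JK; rewrite (class_ltP IC JC xI yJ) (class_ltP JC KC yJ zK) (class_ltP IC KC xI zK).
move=> /andP[xy nyx] /andP[yz nzy]; rewrite (contr_trans xy yz) /=.
by apply: contra nyx => zx; apply: contr_trans yz zx.
Qed.

Local Notation D := (hasse_diagram r).

(** A walk of contraction steps from [I] to [J] stays in these two classes, and
    the step that leaves [I] is a cover relation that is not contracted. *)
Lemma class_cover_edge I J : class_cover r I J ->
  exists x y, [/\ x \in I, y \in J, covers P x y & ~~ r y x].
Proof.
move=> IJ; have lt := coversW IJ; have [IC JC] := class_lt_classes lt.
have [[x xI] [y yJ]] := (class_nonempty IC, class_nonempty JC).
move: (lt); rewrite (class_ltP IC JC xI yJ) => /andP[xy nyx].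
have nyI : y \notin I by rewrite (class_same _ IC xI) sameE xy.
have cxy : connect (contraction_step P r) x y by rewrite -rE.
have [u [v [uv uI nvI xu vy]]] := @connect_exit _ _ (fun z => z \in I) _ _ cxy xI nyI.
rewrite -!rE in xu vy.
have ruv : r u v by rewrite rE; apply: connect1.
have nvu : ~~ r v u by move: nvI; rewrite (class_same _ IC uI) sameE ruv.
have vC := class_of_in v; have vv := mem_class_of v.
have Iv : class_lt r I (class_of v) by rewrite (class_ltP IC vC uI vv) ruv.
have vJ : v \in J.
  rewrite (class_same _ JC yJ) sameE vy andbT; apply/idPn => nyv.
  by apply: (covers_between IJ Iv); rewrite (class_ltP vC JC vv yJ) vy.
exists u, v; split=> //; move: uv => /orP[//|/andP[vu _]].
by rewrite (contr_covers vu) in nvu.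
Qed.

Lemma sym_edge I J : sym_arrow D I J ->
  exists x y, [/\ x \in I, y \in J, adj x y & ~~ same x y].
Proof.
case/orP=> /class_cover_edge[x [y [xI yJ xy nyx]]].
  by exists x, y; split; rewrite // ?sameE ?(negbTE nyx) ?andbF //; apply/orP; left.
by exists y, x; split; rewrite // ?sameE ?(negbTE nyx) //; apply/orP; right.
Qed.

Lemma sym_arrow_classes I J : sym_arrow D I J -> I \in classes /\ J \in classes.
Proof. by case/orP=> /coversW/class_lt_classes[]. Qed.

(** The edge from [x] to [y] is the only one leaving the branch of [y] at
    [x]. *)
Lemma branch_exit x y z w : adj x y -> branch adj x y z -> adj z w ->
  ~~ branch adj x y w -> w = x /\ z = y.
Proof.
move=> xy yz zw nw; have yx : y != x by rewrite eq_sym; apply: (hasse_adj_neq Pirr) xy.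
have zx := branch_neq yx yz.
have wx : w = x.
  apply/eqP; apply: contraNT nw => wx; apply: connect_trans yz (connect1 _).
  by rewrite /delete /= zx wx.
by split=> //; apply/esym; apply: (ac xy _ yz); rewrite -wx adjC.
Qed.

Lemma branch_rootN x y : adj x y -> ~~ branch adj x y x.
Proof.
move=> xy; have yx : y != x by rewrite eq_sym; apply: (hasse_adj_neq Pirr) xy.
by apply/negP => /(branch_neq yx); rewrite eqxx.
Qed.

(** The only edge leaving the branch is not contracted, so a contraction step
    crosses it in one direction only and the branch is a union of classes. *)
Lemma class_branch x y z w : adj x y -> ~~ same x y -> branch adj x y z ->
  same z w -> branch adj x y w.
Proof.
move=> xy nxy yz /andP[zw wz]; apply/idPn => nw.
have [cxy|cyx] := orP xy.
  have nyx : ~~ r y x by move: nxy; rewrite sameE (contr_covers cxy).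
  rewrite rE in zw.
  have [u [v [uv yu nyv _ _]]] := connect_exit zw yz nw.
  have auv : adj u v by case/orP: uv => [uv|/andP[vu _]]; apply/orP; [left|right].
  have [vx uy] := branch_exit xy yu auv nyv; rewrite vx uy in uv.
  case/orP: uv => [uv|/andP[_]]; last exact/negP.
  by rewrite (contr_covers uv) in nyx.
have nxy' : ~~ r x y by move: nxy; rewrite sameE (contr_covers cyx) andbT.
rewrite rE in wz.
have nz : ~~ ~~ branch adj x y z by rewrite negbK.
have [u [v [uv nu yv _ _]]] := @connect_exit _ _ (fun t => ~~ branch adj x y t) _ _ wz nw nz.
rewrite negbK in yv.
have avu : adj v u by case/orP: uv => [uv|/andP[vu _]]; apply/orP; [right|left].
have [ux vy] := branch_exit xy yv avu nu; rewrite ux vy in uv.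
case/orP: uv => [uv|/andP[_]]; last exact/negP.
by rewrite (contr_covers uv) in nxy'.
Qed.

(** Edges between classes come from edges of the tree of [P], and the only one
    leaving the branch ends in [J]. *)
Lemma component_branch J K x y : J \in classes -> x \in J -> adj x y -> ~~ same x y ->
  connect (delete_arrow D J) (class_of y) K -> {subset K <= branch adj x y}.
Proof.
move=> JC xJ xy nxy; have y0 : {subset class_of y <= branch adj x y}.
  by move=> z; rewrite inE => yz; apply: class_branch yz => //; apply: connect0.
case/connectP=> p; elim: p (class_of y) y0 => [|K' p IHp] I Isub /=; first by move=> _ ->.
case/andP=> /and3P[IJ K'J IK'] pp KE; apply: IHp pp KE => w wK'.
have [IC K'C] := sym_arrow_classes IK'.
have [u [v [uI vK' uv _]]] := sym_edge IK'.
apply: (@class_branch x y v) => //; last by rewrite -(class_same _ K'C vK').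
apply: contraNT K'J => nv; have [vx _] := branch_exit xy (Isub u uI) uv nv.
by rewrite (class_eq K'C vK') vx -(class_eq JC xJ).
Qed.

(** If two neighbours of [J] are in one component of the complement of [J],
    then both are attached to [J] by the only edge leaving a branch. *)
Lemma hasse_diagram_acyclic : acyclic (sym_arrow D).
Proof.
move=> J A B JA JB AB; have [JC AC] := sym_arrow_classes JA.
have [_ BC] := sym_arrow_classes JB.
have [x [y [xJ yA xy nxy]]] := sym_edge JA.
have [x' [y' [x'J y'B xy' _]]] := sym_edge JB.
rewrite (class_eq AC yA) in AB; have Bsub := component_branch JC xJ xy nxy AB.
have nx' : ~~ branch adj x y x'.
  apply: contra (branch_rootN xy) => yx'; apply: class_branch yx' _ => //.
  by rewrite -(class_same _ JC x'J).
have y'x' : adj y' x' by rewrite adjC.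
have [_ y'y] := branch_exit xy (Bsub _ y'B) y'x' nx'.
by rewrite (class_eq AC yA) (class_eq BC y'B) y'y.
Qed.

Lemma sym_arrowC : symmetric (sym_arrow D).
Proof. by move=> I J; rewrite /sym_arrow /= orbC. Qed.

Lemma class_connected x y : connect (sym_arrow D) (class_of x) (class_of y).
Proof.
have step u v : r u v -> connect (sym_arrow D) (class_of u) (class_of v).
  move=> uv; have [vu|nvu] := boolP (r v u).
    rewrite (@class_eq (class_of u) v); rewrite ?class_of_in ?connect0 //.
    by rewrite inE sameE uv.
  have lt : class_lt r (class_of u) (class_of v).
    by rewrite (class_ltP (class_of_in u) (class_of_in v) (mem_class_of u) (mem_class_of v)) uv.
  have := connect_covers class_lt_irr class_lt_tr lt.
  by apply: connect_sub => I J IJ; apply: connect1; apply/orP; left.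
have sc := sym_connect_sym sym_arrowC.
have := conn x y; case/connectP=> p; elim: p x => [|z p IHp] x /=.
  by move=> _ ->; apply: connect0.
case/andP=> xz pz yE; apply: connect_trans (IHp z pz yE).
by case/orP: xz => /contr_covers/step //; rewrite sc.
Qed.

Lemma hasse_diagram_tree : (0 < n)%N -> directed_tree D.
Proof.
move=> n0; split.
- by move=> I J /= /coversW/class_lt_classes[IC JC]; apply/andP.
- move=> I J; apply/negP => /andP[/coversW IJ /coversW JI].
  by have := class_lt_tr IJ JI; rewrite class_lt_irr.
- by apply/set0Pn; exists (class_of (Ordinal n0)); apply: class_of_in.
- move=> I J IC JC; have [[x xI] [y yJ]] := (class_nonempty IC, class_nonempty JC).
  by rewrite (class_eq IC xI) (class_eq JC yJ); apply: class_connected.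
- exact: acyclic_no_ucycle sym_arrowC hasse_diagram_acyclic.
Qed.

(** A walk of contraction steps between equivalent elements never leaves their
    class. *)
Lemma class_path J a b : J \in classes -> a \in J -> b \in J ->
  exists l, [/\ path adj a l, last a l = b, uniq (a :: l) & {subset a :: l <= J}].
Proof.
move=> JC aJ bJ; have: same a b by rewrite -(class_same _ JC aJ).
case/andP; rewrite rE => /connectP[p pp bE] rba.
have [pa pJ] : path adj a p /\ {subset a :: p <= J}.
  elim: p a aJ pp bE rba => [|z p IHp] a aJ /=.
    by move=> _ _ _; split=> // z; rewrite inE => /eqP->.
  case/andP=> az pz bE rba; have raz : r a z by rewrite rE; apply: connect1.
  have rzb : r z b by rewrite rE; apply/connectP; exists p.
  have zJ : z \in J by rewrite (class_same _ JC aJ) sameE raz (contr_trans rzb rba).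
  have rbz : r b z by have := class_same b JC zJ; rewrite bJ => /esym/andP[].
  have [pz' pJ] := IHp z zJ pz bE rbz; split.
    by rewrite pz' andbT; case/orP: az => [az|/andP[za _]]; apply/orP; [left|right].
  by move=> u; rewrite inE => /orP[/eqP->|/pJ].
move: bE; case/shortenP: pa => l pl ul lp bE; exists l; split=> // u.
rewrite inE => /orP[/eqP->//|ul']; apply: pJ; rewrite inE; apply/orP; right; exact: lp.
Qed.

(** Ancestor and descendant subtrees correspond to the two orientations [dir]
    of the edges between classes, together with the orientation [cov] of the
    edges of the tree of [P]. *)
Section Separation.
Variables (h : 'I_n -> nat) (cov : rel 'I_n) (dir : rel {set 'I_n}).
Hypothesis covE : forall u v, adj u v = cov u v || cov v u.
Hypothesis sep : forall j a b, cov j a -> cov j b -> a != b ->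
  separates h j (branch adj j a) (branch adj j b).
Hypothesis dir_edge : forall I J, dir I J ->
  exists x y, [/\ x \in I, y \in J, cov x y & ~~ same x y].

Lemma subtrees_separated J A B : J \in classes -> A \in classes -> B \in classes ->
  dir J A -> dir J B -> component_without D J A != component_without D J B ->
  exists2 j, j \in J & separates h j (mem (cover (component_without D J A)))
                                      (mem (cover (component_without D J B))).
Proof.
move=> JC AC BC /dir_edge[a [p [aJ pA ap nap]]] /dir_edge[b [q [bJ qB bq nbq]]] AB.
have AE := class_eq AC pA; have BE := class_eq BC qB.
have pq : p != q by apply: contraNneq AB => pq; rewrite AE BE pq.
have [l [pl lb ul lJ]] := class_path JC aJ bJ.
have nin x y : x \in J -> ~~ same x y -> y \notin a :: l.
  by move=> xJ nxy; apply: contra nxy => /lJ; rewrite (class_same _ JC xJ).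
rewrite -lb in bq.
have [c cin sc] := valley_separates adjC covE ac sep pl ul ap bq
  (nin _ _ aJ nap) (nin _ _ bJ nbq) pq.
exists c; first exact: lJ.
have sub x y I : x \in J -> cov x y -> ~~ same x y -> I = class_of y ->
    {subset mem (cover (component_without D J I)) <= branch adj x y}.
  move=> xJ xy nxy -> z /bigcupP[K]; rewrite inE => /andP[_ yK] zK.
  by apply: (component_branch JC xJ _ nxy yK) => //; rewrite covE xy.
rewrite lb in sc bq.
by apply: separates_sub sc; apply: sub.
Qed.

End Separation.

End Contraction.

Lemma branch_separates_op (T : finType) (P : rel T) h up down j a b :
  walled P h up down -> covers P a j -> covers P b j -> a != b ->
  separates h j (branch (hasse_adj P) j a) (branch (hasse_adj P) j b).
Proof.
move=> w; rewrite -!(covers_op P) => aj bj ab.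
have adjop : hasse_adj (fun x y => P y x) =2 hasse_adj P.
  move=> x y; rewrite hasse_adjC.
  by rewrite /hasse_adj; congr orb; [apply: (covers_op P y x)|apply: (covers_op P x y)].
have sub x : {subset branch (hasse_adj P) j x
                  <= branch (hasse_adj (fun x y => P y x)) j x}.
  by move=> z; apply: connect_sub => u v uv; apply: connect1; rewrite /delete /= adjop.
exact: separates_sub (sub a) (sub b) (branch_separates (walled_op w) aj bj ab).
Qed.

Theorem proposition4p13 (R : realType) (n : nat) (e : rel 'S_n)
    (r : rel 'I_n) :
  (1 <= n)%N ->
  lattice_congruence e ->
  essential e ->
  simple e ->
  congruence_preposet R e r ->
  schroder_separating_tree (hasse_diagram r).
Proof.
move=> n0 econ eess esimple [rpre [s0 rface]].
have w := class_poset_walled s0 econ esimple.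
have rE := face_contraction econ rpre rface.
have ac := hasse_acyclic w; have conn := hasse_connected s0 econ esimple eess.
have Pirr := walled_irr w.
split.
- exact: (preposet_classes_partition rE).
- exact: (hasse_diagram_tree Pirr ac conn rE n0).
move=> J JC; split=> U V.
  case/imsetP=> A; rewrite inE => /andP[AC JA] ->.
  case/imsetP=> B; rewrite inE => /andP[BC JB] -> AB.
  apply: (@subtrees_separated _ _ r Pirr ac rE (@nat_of_ord n)
    (covers (class_poset e s0)) (class_cover r)) => //.
  - by move=> j a b; apply: (branch_separates w).
  - move=> I K /(class_cover_edge rE)[x [y [xI yK xy nyx]]].
    by exists x, y; split; rewrite // sameE (negbTE nyx) andbF.
case/imsetP=> A; rewrite inE => /andP[AC JA] ->.
  case/imsetP=> B; rewrite inE => /andP[BC JB] -> AB.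
apply: (@subtrees_separated _ _ r Pirr ac rE (@nat_of_ord n)
  (fun x y => covers (class_poset e s0) y x) (fun I K => class_cover r K I)) => //.
- by move=> u v; rewrite orbC.
- by move=> j a b; apply: (branch_separates_op w).
move=> I K /(class_cover_edge rE)[x [y [xK yI xy nyx]]].
by exists y, x; split; rewrite // sameE (negbTE nyx).
Qed.
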